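(* Consider a sequence of problems indexed by the sample size $n\to\infty$ (the dimension $d$, the graph classes and $\theta>0$ may depend on $n$). Let $\mathcal G_1$ be a nonempty class of graphs on $\overline V=\{1,\dots,d\}$ not containing the empty graph, let $\mathcal R=\min_{G\in\mathcal G_1}\mathcal R(G)$ be the minimal arboricity, and let $\mathcal G^*$ be a non-empty subset of $\mathcal G_1$ such that all graphs in $\mathcal G^*$ have arboricity $\mathcal R$. Define $N(\mathcal G^* )=\max_{G\in\mathcal G^*}\mathbb E_{G'\sim U(\mathcal G^* )}|V(G)\cap V(G')|$, where $U(\mathcal G^* )$ is the uniform distribution over $\mathcal G^*$. Let $V_{\max}=\max_{G\in\mathcal G^*}|V(G)|$, $\Lambda=\max_{G\in\mathcal G^*}\|A_G\|_F$, $\Gamma=\max_{G\in\mathcal G^*}\|A_G\|_1$ and $\mathcal B=512\{\Lambda^4\wedge[V_{\max}(\Gamma\vee\Lambda)^2]\}$. If $\mathcal G^*$ is incoherent, $N(\mathcal G^* )=o(1)$, and $$\theta\le\sqrt{\frac{\log[N^{-1}(\mathcal G^* )]}{6n\mathcal R}}\ \wedge\ \sqrt{\frac{\mathcal R}{\mathcal B}}\ \wedge\ \frac{1}{8(\Lambda\vee\Gamma)},$$ where $N^{-1}(\mathcal G^* )=1/N(\mathcal G^* )$, then, with $\mathcal S^*=\{\theta A_G: G\in\mathcal G^*\}$, $$\liminf_{n\to\infty}\gamma(\mathcal S^* )=1.$$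
   Context: Graphs are simple undirected graphs on $\overline V=\{1,\dots,d\}$. $V(G)$ denotes the set of non-isolated vertices of $G$, $E(G)$ its edge set, $A_G$ its adjacency matrix. $\|A\|_F$ is the Frobenius norm and $\|A\|_1$ the $\ell_1\to\ell_1$ operator norm (maximum absolute column sum). $a\wedge b=\min$, $a\vee b=\max$. Arboricity: $\mathcal R(G)=\big\lceil\max_{V\subseteq\overline V}\frac{|E(G_V)|}{|V|-1}\big\rceil$, where $G_V$ is obtained from $G$ by removing all edges having an endpoint outside $V$, and $0/0:=0$. Zero-field ferromagnetic Ising model: for a symmetric $\Theta=(\theta_{ij})\in\mathbb R^{d\times d}$ with zero diagonal and nonnegative entries, $\mathbb P_\Theta$ is the distribution on $\{\pm1\}^d$ with $\mathbb P_\Theta(X)=\frac1{Z_\Theta}\exp\big(\sum_{i,j=1}^d\theta_{ij}X_iX_j\big)$, where $Z_\Theta$ is the normalizing constant (the sum runs over all ordered pairs $(i,j)$). $\mathbb P_{\Theta,n}$ is the joint law of $n$ i.i.d. samples, and $\mathbb P_{0,n}$ is the case $\Theta=0$. Minimax risk: $\gamma(\mathcal S^* )=\inf_\psi\big[\mathbb P_{0,n}(\psi=1)+\max_{\Theta\in\mathcal S^*}\mathbb P_{\Theta,n}(\psi=0)\big]$, the infimum being over all measurable tests $\psi$, i.e. $\{0,1\}$-valued functions of the $n$ samples. Negative association: random variables $Y_1,\dots,Y_k$ are negatively associated if for all $k_1,k_2\ge0$ with $k_1+k_2\le k$, all distinct indices $i_1,\dots,i_{k_1},j_1,\dots,j_{k_2}$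 and all coordinatewise non-decreasing functions $f,g$, $\mathrm{Cov}[f(Y_{i_1},\dots,Y_{i_{k_1}}),g(Y_{j_1},\dots,Y_{j_{k_2}})]\le0$. Incoherence: $\mathcal G^*$ is incoherent if for any fixed graph $G$, the binary random variables $\{\mathbf 1[i\in V(G')]\}_{i\in V(G)}$ are negatively associated when $G'$ is sampled uniformly from $\mathcal G^*$. *)

(* Defs.v *)
From HB Require Import structures.
From mathcomp Require Import all_boot all_order all_algebra.
From mathcomp Require Import all_classical all_reals all_analysis.
Set Implicit Arguments.
Unset Strict Implicit.
Unset Printing Implicit Defensive.
Import Order.TTheory GRing.Theory Num.Theory.
Import numFieldNormedType.Exports.
Local Open Scope ring_scope.

(* A graph is its set of edges, an edge being a set of two distinct vertices. *)
Record sgraph (d : nat) := SGraph {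
  edges : {set {set 'I_d}};
  _ : [forall e in edges, #|e| == 2%N] }.
HB.instance Definition _ (d : nat) := [isSub for @edges d].
HB.instance Definition _ (d : nat) := [Finite of sgraph d by <:].

(* [set i; i] is a singleton, hence never an edge: adj G is irreflexive. *)
Definition adj (d : nat) (G : sgraph d) : rel 'I_d :=
  fun i j => [set i; j]%SET \in edges G.

(* The non-isolated vertices of G. *)
Definition vertices (d : nat) (G : sgraph d) : {set 'I_d} :=
  [set i | [exists j, adj G i j]]%SET.

Definition adjmx (R : realType) (d : nat) (G : sgraph d) : 'M[R]_d :=
  \matrix_(i, j) (adj G i j)%:R.

Definition num_edges_in (d : nat) (G : sgraph d) (V : {set 'I_d}) : nat :=
  #|[set e in edges G | e \subset V]%SET|.

(* Division by zero in rat returns 0, which is the convention 0/0 = 0 needed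
   when #|V| = 1; when V is empty the quotient is 0 / (-1) = 0.  All quotients
   are nonnegative, so taking the maximum with 0 is harmless. *)
Definition arboricity (d : nat) (G : sgraph d) : nat :=
  absz (Num.ceil (\big[Order.max/(0 : rat)]_(V : {set 'I_d})
                    ((num_edges_in G V)%:R / (#|V|%:R - 1)))).

(* The default value of the iterated minimum is the maximum over the class, so
   this is the genuine minimum as soon as C is nonempty. *)
Definition min_arboricity (d : nat) (C : {set sgraph d}) : nat :=
  \big[minn/(\max_(G in C) arboricity G)%N]_(G in C) arboricity G.

Section MatrixNorms.
Variables (R : realType) (d : nat).
Implicit Type A : 'M[R]_d.

Definition frobenius_norm A : R := Num.sqrt (\sum_i \sum_j A i j ^+ 2).

Definition opnorm1 A : R := \big[Order.max/0]_j \sum_i `|A i j|.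

End MatrixNorms.

Section Uniform.
Variables (R : realType) (T : finType) (C : {set T}).

Definition unif_mean (X : T -> R) : R := (\sum_(t in C) X t) / #|C|%:R.

Definition unif_cov (X Y : T -> R) : R :=
  unif_mean (fun t => (X t - unif_mean X) * (Y t - unif_mean Y)).

End Uniform.

Definition coord_nondecreasing (R : realType) (k : nat) (f : k.-tuple R -> R) :=
  forall x y : k.-tuple R, (forall i, tnth x i <= tnth y i) -> f x <= f y.

(* The random variables are the Y_i for i in A, under the uniform distribution
   on C. *)
Definition neg_associated (R : realType) (T : finType) (C : {set T})
    (I : finType) (A : {set I}) (Y : I -> T -> R) : Prop :=
  forall (k1 k2 : nat) (s1 : k1.-tuple I) (s2 : k2.-tuple I)
         (f : k1.-tuple R -> R) (g : k2.-tuple R -> R),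
    (k1 + k2 <= #|A|)%N ->
    uniq (s1 ++ s2) -> {subset s1 ++ s2 <= A} ->
    coord_nondecreasing f -> coord_nondecreasing g ->
    unif_cov C (fun t => f [tuple Y (tnth s1 a) t | a < k1])
               (fun t => g [tuple Y (tnth s2 a) t | a < k2]) <= 0.

Section GraphClass.
Variables (R : realType) (d : nat) (C : {set sgraph d}).

Definition incoherent : Prop :=
  forall G : sgraph d,
    neg_associated C (vertices G)
      (fun (i : 'I_d) (G' : sgraph d) => (i \in vertices G')%:R : R).

Definition mean_overlap : R :=
  \big[Order.max/0]_(G in C)
    unif_mean C (fun G' => #|(vertices G :&: vertices G')%SET|%:R).

Definition Vmax : nat := (\max_(G in C) #|vertices G|)%N.

Definition Lambda : R :=
  \big[Order.max/0]_(G in C) frobenius_norm (adjmx R G).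

Definition Gamma : R :=
  \big[Order.max/0]_(G in C) opnorm1 (adjmx R G).

Definition calB : R :=
  512 * Order.min (Lambda ^+ 4) (Vmax%:R * Order.max Gamma Lambda ^+ 2).

End GraphClass.

Notation config d := {ffun 'I_d -> bool}.

Section Ising.
Variables (R : realType) (d : nat).
Implicit Types (Theta : 'M[R]_d) (S : set 'M[R]_d).

Definition spin (x : config d) (i : 'I_d) : R := if x i then 1 else -1.

Definition ising_weight Theta (x : config d) : R :=
  expR (\sum_i \sum_j Theta i j * spin x i * spin x j).

Definition partition_function Theta : R := \sum_x ising_weight Theta x.

Definition ising Theta (x : config d) : R :=
  ising_weight Theta x / partition_function Theta.

Definition ising_prob (n : nat) Theta (E : pred (n.-tuple (config d))) : R :=
  \sum_(x : n.-tuple (config d) | E x) \prod_(k < n) ising Theta (tnth x k).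

(* The sample space is finite, so every function to bool is a measurable test;
   psi x = true means that the null hypothesis Theta = 0 is rejected.  For a
   finite S the supremum is the maximum. *)
Definition test_risk (n : nat) S (psi : n.-tuple (config d) -> bool) : R :=
  ising_prob 0 psi
  + sup [set ising_prob Theta (fun x => ~~ psi x) | Theta in S]%classic.

Definition minimax_risk (n : nat) S : R := inf (range (@test_risk n S)).

End Ising.

(* Main.v *)
Require Import Defs.
From mathcomp Require Import all_boot all_order all_algebra.
From mathcomp Require Import all_classical all_reals all_analysis.
From mathcomp Require Import ring lra zify.
Import Order.TTheory GRing.Theory Num.Theory.
Import numFieldNormedType.Exports.
Local Open Scope ring_scope.
Local Open Scope classical_set_scope.

(** By Le Cam's method it suffices that the mean over G, G' of
    rho(G, G')^n tends to 1, where rho(G, G') is the normalised inner product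
    of the likelihood ratios, that is 2^d sum_x P_G(x) P_G'(x).

    To bound rho, take independent copies x ~ P_G and y ~ P_G' and glue them one
    vertex at a time by the factors 1 + x_i y_i: the total mass goes from
    Z_G Z_G' to 2^d sum_x W_G(x) W_G'(x), where W is the unnormalised weight and
    Z the partition function, and gluing vertex m multiplies it by
    1 + <x_m y_m>, the correlation being taken in the model where the vertices
    i < m are already glued.  The first Griffiths inequality gives Fisher's
    bound, <x_i y_m> <= 2 theta sum_k A_ik <x_k y_m> (plus the neighbours in the
    other graph when i is glued), so that <x_m y_m> is at most a weighted sum
    over the walks from m to m that start in G and end in G'.  The walks of
    length 2 contribute the common edges, bounded by the arboricity; those of
    length 3 and more are controlled by the other two bounds on theta.
    Altogether rho <= exp (5 theta^2 R |S|) with S the common vertices, and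
    negative association turns the moment of exp (c |S|) into a product. *)

(** * Spin moments of a pair of configurations: the inequalities of Griffiths and Fisher *)

Section Moments.
Set Implicit Arguments.
Unset Strict Implicit.
Variables (R : realType) (d : nat).

Local Notation site := (bool * 'I_d)%type.
Local Notation conf2 := (config d * config d)%type.

(** The boolean of a site selects the copy: [false] for the first configuration of the pair, [true]
    for the second. *)
Definition spin2 (a : site) (w : conf2) : R :=
  spin R (if a.1 then w.2 else w.1) a.2.

Definition moment (f : conf2 -> R) (s : seq site) : R :=
  \sum_w f w * \prod_(a <- s) spin2 a w.

(** The conclusion of the first Griffiths inequality, taken as a property of unnormalised weights so
    that it propagates one factor at a time. *)
Definition griffiths (f : conf2 -> R) : Prop := forall s, 0 <= moment f s.

Lemma spin2_cases a w : spin2 a w = 1 \/ spin2 a w = -1.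
Proof. by rewrite /spin2 /spin; case: ifP => _; [left|right]. Qed.

Lemma spin2_sqr a w : spin2 a w * spin2 a w = 1.
Proof. by case: (spin2_cases a w) => ->; rewrite ?mulrNN mulr1. Qed.

Lemma moment_sqr f a s : moment f (a :: a :: s) = moment f s.
Proof.
by apply: eq_bigr => w _; rewrite !big_cons [X in _ * X]mulrA spin2_sqr mul1r.
Qed.

Lemma moment_perm f s1 s2 : perm_eq s1 s2 -> moment f s1 = moment f s2.
Proof. by move=> s12; apply: eq_bigr => w _; rewrite (perm_big _ s12). Qed.

Definition flip (F : {set site}) (w : conf2) : conf2 :=
  ([ffun i => w.1 i (+) ((false, i) \in F)],
   [ffun i => w.2 i (+) ((true, i) \in F)]).

Lemma flipK F : involutive (flip F).
Proof.
by case=> x y; congr (_, _); apply/ffunP => i; rewrite !ffunE -addbA addbb addbF.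
Qed.

Lemma spin2_flip F a w :
  spin2 a (flip F w) = (-1) ^+ (a \in F) * spin2 a w.
Proof.
case: a => -[] i; rewrite /spin2 /spin /= ffunE;
  case: (_ \in F); rewrite ?addbT ?addbF /= ?expr0 ?mul1r // expr1;
  by case: (_ i); rewrite /= ?mulN1r ?opprK.
Qed.

(** Flipping [F] is a bijection that preserves [f] and changes the sign of the spin product, so the
    moment equals its own negative. *)
Lemma moment_flip0 F f s : (forall w, f (flip F w) = f w) ->
  odd (count [in F] s) -> moment f s = 0.
Proof.
move=> fF odds.
suff /eqP : moment f s = - moment f s by rewrite -addr_eq0 -mulr2n mulrn_eq0 /= => /eqP.
rewrite {1}/moment (reindex_inj (can_inj (flipK F))) -sumrN.
apply: eq_bigr => w _; rewrite fF -mulrN; congr (_ * _).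
rewrite (eq_bigr (fun a => (-1) ^+ (a \in F) * spin2 a w)); last first.
  by move=> a _; rewrite spin2_flip.
rewrite big_split /= -[RHS]mulN1r; congr (_ * _).

rewrite -[RHS](_ : (-1) ^+ count [in F] s = -1); last by rewrite -signr_odd odds expr1.
elim: s {odds} => [|a s IH]; first by rewrite big_nil.
by rewrite big_cons IH /= exprD.
Qed.

(** A site of odd multiplicity kills the moment when it is flipped alone; if all multiplicities are
    even, every term is a product of even powers. *)
Lemma griffiths1 : griffiths (fun=> 1).
Proof.
move=> s; have [/existsP[a odda]|/existsPn evens] :=
    boolP [exists a, odd (count_mem a s)].
  rewrite (@moment_flip0 [set a]) //.
  by rewrite (eq_count (a2 := pred1 a)) // => b; rewrite /= inE.
apply: sumr_ge0 => w _; rewrite mul1r.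
rewrite (eq_bigr (fun a => \prod_b (spin2 b w) ^+ (b == a))); last first.
  move=> a _; rewrite (bigD1 a) //= eqxx expr1 big1 ?mulr1 // => b /negPf ->.
  by rewrite expr0.
rewrite exchange_big /=; apply: prodr_ge0 => b _.
rewrite (_ : \prod_(i <- s) _ = spin2 b w ^+ count_mem b s).
  by apply: exprn_even_ge0; apply: evens.
elim: s {evens} => [|a s IH]; first by rewrite big_nil.
by rewrite big_cons IH /= exprD eq_sym.
Qed.

Lemma moment_linear f a b p q s :
  moment (fun w => f w * (a + b * (spin2 p w * spin2 q w))) s
  = a * moment f s + b * moment f (p :: q :: s).
Proof.
rewrite /moment !mulr_sumr -big_split; apply: eq_bigr => w _.
by rewrite /= !big_cons; ring.
Qed.

Lemma griffiths_linear f a b p q : 0 <= a -> 0 <= b -> griffiths f ->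
  griffiths (fun w => f w * (a + b * (spin2 p w * spin2 q w))).
Proof.
by move=> a0 b0 f0 s; rewrite moment_linear addr_ge0 ?mulr_ge0.
Qed.

Definition ch (a : R) := (expR a + expR (- a)) / 2.
Definition sh (a : R) := (expR a - expR (- a)) / 2.

Lemma expR_spin2 a p q w :
  expR (a * (spin2 p w * spin2 q w)) = ch a + sh a * (spin2 p w * spin2 q w).
Proof.
rewrite /ch /sh; case: (spin2_cases p w) => ->; case: (spin2_cases q w) => ->;
  rewrite ?(mulrNN, mulrN, mulNr, mulr1, mul1r, opprK); lra.
Qed.

Lemma ch_ge0 a : 0 <= ch a.
Proof. by rewrite divr_ge0 // addr_ge0 // expR_ge0. Qed.

Lemma sh_ge0 a : 0 <= a -> 0 <= sh a.
Proof. by move=> a0; rewrite divr_ge0 // subr_ge0 ler_expR; lra. Qed.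

(** The function [x * ch x - sh x] vanishes at 0 and has derivative [x * sh x], which is nonnegative
    for [x >= 0]. *)
Lemma sh_le a : 0 <= a -> sh a <= a * ch a.
Proof.
move=> a0.
have dch y : is_derive y (1 : R) (fun x => x * ch x - sh x) (y * sh y).
  rewrite /ch /sh; apply: is_derive_eq.
  by rewrite /GRing.scale /=; lra.
have [] := @MVT_segment R (fun x => x * ch x - sh x) (fun x => x * sh x) 0 a a0.
- by apply: derivable_within_continuous => x _; exact: ex_derive.
move=> c; rewrite in_itv /= => /andP[c0 ca].
have -> : sh 0 = 0 by rewrite /sh oppr0 subrr mul0r.
rewrite mul0r !subr0 => h; rewrite -subr_ge0 h mulr_ge0 // mulr_ge0 // sh_ge0 //.
Qed.


Lemma moment_expR f a p q s :
  moment (fun w => f w * expR (a * (spin2 p w * spin2 q w))) s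
  = ch a * moment f s + sh a * moment f (p :: q :: s).
Proof.
rewrite -moment_linear; apply: eq_bigr => w _; by rewrite expR_spin2.
Qed.

Lemma griffiths_expR f a p q : 0 <= a -> griffiths f ->
  griffiths (fun w => f w * expR (a * (spin2 p w * spin2 q w))).
Proof.
by move=> a0 f0 s; rewrite moment_expR; apply: addr_ge0; apply: mulr_ge0 => //;
  [exact: ch_ge0 | exact: sh_ge0].
Qed.

Lemma eq_moment f g s : f =1 g -> moment f s = moment g s.
Proof. by move=> fg; apply: eq_bigr => w _; rewrite fg. Qed.

Lemma eq_griffiths f g : f =1 g -> griffiths f -> griffiths g.
Proof. by move=> fg f0 s; rewrite -(eq_moment s fg). Qed.

Section Bonds.
Variables (I : Type) (a : I -> R) (p q : I -> site).
Hypothesis a_ge0 : forall r, 0 <= a r.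

Definition bonds (L : seq I) (w : conf2) : R :=
  \prod_(r <- L) expR (a r * (spin2 (p r) w * spin2 (q r) w)).

Lemma bonds_cons f r L w : f w * bonds (r :: L) w =
  f w * bonds L w * expR (a r * (spin2 (p r) w * spin2 (q r) w)).
Proof. by rewrite /bonds big_cons mulrCA mulrC. Qed.

Lemma griffiths_bonds f L : griffiths f -> griffiths (fun w => f w * bonds L w).
Proof.
move=> f0; elim: L => [|r L IH].
  by apply: eq_griffiths f0 => w; rewrite /bonds big_nil mulr1.
apply: eq_griffiths (griffiths_expR (p r) (q r) (a_ge0 r) IH) => w.
by rewrite bonds_cons.
Qed.

(* Fisher's inequality. A bond factor is [ch a + sh a * chi] with [sh a <= a * ch a],
   so peeling off one bond at a time only requires the monotonicity given by the
   first Griffiths inequality. *)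
Lemma moment_bonds_le f L s : griffiths f -> moment f s = 0 ->
  moment (fun w => f w * bonds L w) s <=
  \sum_(r <- L) a r * moment (fun w => f w * bonds L w) [:: p r, q r & s].
Proof.
move=> f0 fs; elim: L => [|r L IH].
  rewrite big_nil (eq_moment (g := f)) ?fs // => w.
  by rewrite /bonds big_nil mulr1.
have E t : moment (fun w => f w * bonds (r :: L) w) t =
    ch (a r) * moment (fun w => f w * bonds L w) t +
    sh (a r) * moment (fun w => f w * bonds L w) [:: p r, q r & t].
  by rewrite -moment_expR; apply: eq_moment => w; rewrite bonds_cons.
have G := griffiths_bonds L f0.
rewrite big_cons E addrC lerD //.
  apply: (@le_trans _ _ (a r * ch (a r) *
      moment (fun w => f w * bonds L w) [:: p r, q r & s])).
    by rewrite ler_wpM2r // sh_le.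
  rewrite -mulrA ler_wpM2l // E lerDl mulr_ge0 // sh_ge0 //.
apply: (@le_trans _ _ (ch (a r) * \sum_(r' <- L)
    a r' * moment (fun w => f w * bonds L w) [:: p r', q r' & s])).
  by rewrite ler_wpM2l // ch_ge0.
rewrite mulr_sumr; apply: ler_sum => r' _.
by rewrite mulrCA ler_wpM2l // E lerDl mulr_ge0 // sh_ge0.
Qed.

End Bonds.

End Moments.

(** * Two Ising models glued along their first vertices *)

Section Glued.
Set Implicit Arguments.
Unset Strict Implicit.
Variables (R : realType) (d : nat).
Local Notation site := (bool * 'I_d)%type.
Local Notation conf2 := (config d * config d)%type.
Local Notation spin2 := (@spin2 R d).
Implicit Types (J : bool -> 'M[R]_d) (w : conf2).

Definition energy J w : R :=
  \sum_c \sum_i \sum_j J c i j * (spin2 (c, i) w * spin2 (c, j) w).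

(** Each factor is 2 where the two copies agree and 0 where they differ, so gluing all vertices
    confines the pair to the diagonal. *)
Definition gluing (m : nat) w : R :=
  \prod_(i < d | (i < m)%N) (1 + spin2 (false, i) w * spin2 (true, i) w).

Definition glued J (m : nat) w : R := gluing m w * expR (energy J w).

Lemma griffiths_gluing m : griffiths (gluing m).
Proof.
rewrite /gluing; elim: (index_enum _) => [|i L IH].
  by apply: eq_griffiths (@griffiths1 R d) => w; rewrite big_nil.
case im : (i < m)%N; last first.
  by apply: eq_griffiths IH => w; rewrite big_cons im.
apply: eq_griffiths (griffiths_linear (false, i) (true, i) ler01 ler01 IH) => w.
by rewrite big_cons im mul1r mulrC.
Qed.

Lemma griffiths_glued J m : (forall c i j, 0 <= J c i j) -> griffiths (glued J m).
Proof.
move=> J0.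
pose a (r : bool * ('I_d * 'I_d)) := J r.1 r.2.1 r.2.2.
apply: eq_griffiths (@griffiths_bonds R d _ a (fun r => (r.1, r.2.1))
  (fun r => (r.1, r.2.2)) _ (gluing m) (index_enum _) (griffiths_gluing m)) => [w|r].
  rewrite /glued; congr (_ * _); rewrite /bonds -expR_sum; congr expR.
  rewrite /energy pair_bigA /= pair_bigA /=.
  rewrite (reindex_onto (fun r : bool * ('I_d * 'I_d) => (r.1, r.2.1, r.2.2))
    (fun r => (r.1.1, (r.1.2, r.2)))) /=.
    by apply: eq_bigl => -[? [? ?]]; rewrite /= eqxx.
  by case=> [[? ?] ?].
exact: J0.
Qed.

(** The two copies of a glued vertex carry equal spins wherever the weight is nonzero:
    [(1 + s) * s = 1 + s] for a sign [s]. *)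
Lemma moment_glued J m c c' (i : 'I_d) s : (i < m)%N || (c == c') ->
  moment (glued J m) [:: (c', i), (c, i) & s] = moment (glued J m) s.
Proof.
have [<- _|cc'] := eqVneq c c'; first exact: moment_sqr.
rewrite orbF => im; apply: eq_bigr => w _.
rewrite !big_cons [X in _ * X]mulrA mulrA; congr (_ * _).
rewrite /glued mulrAC; congr (_ * _); rewrite /gluing (bigD1 i) //=.
rewrite mulrAC; congr (_ * _).
rewrite (_ : _ * spin2 (c, i) w = spin2 (false, i) w * spin2 (true, i) w).
  by have := spin2_cases R (false, i) w; have := spin2_cases R (true, i) w;
    case=> ->; case=> ->; ring.
by case: c c' cc' => -[] //; rewrite mulrC.
Qed.

(* [act] selects the copies of [i] that will be flipped together: both of them
   once [i] is glued, only one before. *)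
Definition cut J (act : pred bool) (i : 'I_d) c : 'M[R]_d :=
  \matrix_(p, q) (if act c && ((p == i) || (q == i)) then 0 else J c p q).

(** The factor 2 arises because the energy runs over ordered pairs, so each bond at [i] occurs
    twice. *)
Lemma energy_cut J act i w : (forall c, (J c)^T = J c) -> (forall c, J c i i = 0) ->
  energy J w = energy (cut J act i) w +
    \sum_(r : site) (act r.1)%:R * (2 * J r.1 i r.2) *
      (spin2 (r.1, i) w * spin2 r w).
Proof.
move=> Jsym Jii.
rewrite -(pair_bigA _ (fun c k => (act c)%:R * (2 * J c i k) * (spin2 (c, i) w * spin2 (c, k) w))) /=.
rewrite -big_split; apply: eq_bigr => c _ /=.
have [actc|nactc] := boolP (act c); last first.
  rewrite [X in _ + X]big1 ?addr0; last by move=> k _; rewrite !mul0r.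
  by do 2!(apply: eq_bigr => ? _); rewrite mxE (negPf nactc).
set h := fun p q => J c p q * (spin2 (c, p) w * spin2 (c, q) w).
have hsym p q : h p q = h q p by rewrite /h [spin2 (c, p) w * _]mulrC -{1}(Jsym c) mxE.
rewrite (eq_bigr (fun p => \sum_q h p q)) // (bigD1 i) //=.
rewrite [X in _ = X + _](bigD1 i) //= [X in _ = X + _ + _]big1 ?add0r; last first.
  by move=> q _; rewrite mxE actc eqxx mul0r.
rewrite addrC [\sum_k (1 * _ * _)](_ : _ = \sum_k h i k + \sum_k h i k); last first.
  by rewrite -big_split; apply: eq_bigr => k _; rewrite /h /=; ring.
rewrite addrA; congr (_ + _).
rewrite [X in _ = _ + X](bigD1 i) //= {2}/h Jii mul0r add0r -big_split /=.
apply: eq_bigr => p pi; rewrite (bigD1 i) //= [X in _ = X + _](bigD1 i) //=.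
rewrite mxE actc eqxx orbT mul0r add0r addrC hsym; congr (_ + _).
by apply: eq_bigr => q qi; rewrite mxE (negPf pi) (negPf qi) andbF.
Qed.

(** Fisher's inequality, starting from the model where the bonds at the active copies of [i] are
    cut. Flipping these copies preserves the cut weight, since a glued [i] is flipped in both copies
    or in none. It flips [(c, i)] but not [b], so the moment of the cut model vanishes. *)
Lemma moment_glued_le J m (act : pred bool) c i b :
  (forall c i j, 0 <= J c i j) ->
  (forall c, (J c)^T = J c) -> (forall c, J c i i = 0) ->
  ((i < m)%N -> act false = act true) ->
  act c -> ~~ ((b.2 == i) && act b.1) ->
  moment (glued J m) [:: (c, i); b] <=
  \sum_c' \sum_k (act c')%:R * (2 * J c' i k) *
     moment (glued J m) [:: (c', i); (c', k); (c, i); b].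
Proof.
move=> J0 Jsym Jii acti actc nb.
pose F := [set a : site | (a.2 == i) && act a.1]%SET.
have J'0 c' p q : 0 <= cut J act i c' p q by rewrite mxE; case: ifP.
pose a (r : site) := (act r.1)%:R * (2 * J r.1 i r.2).
have a0 r : 0 <= a r by rewrite !mulr_ge0.
have E : (fun w => glued (cut J act i) m w * bonds a (fun r => (r.1, i)) id (index_enum _) w) =1 glued J m.
  move=> w; rewrite /glued -mulrA /bonds -expR_sum -expRD; congr (_ * expR _).
  by rewrite -energy_cut.
have := @moment_bonds_le R d _ a (fun r => (r.1, i)) id a0 (glued (cut J act i) m)
  (index_enum _) [:: (c, i); b] (griffiths_glued m J'0).
rewrite (eq_moment _ E); under eq_bigr do rewrite (eq_moment _ E).
rewrite pair_bigA /= (eq_bigr (fun r => a (r.1, r.2) *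
  moment (glued J m) [:: (r.1, i); (r.1, r.2); (c, i); b])); last by case.
apply; apply: (@moment_flip0 R d F) => [w|]; last first.
  by rewrite /= !inE /= eqxx actc (negPf nb).
rewrite /glued; congr (_ * expR _).
  apply: eq_bigr => j jm; rewrite !spin2_flip !inE /=.
  have [ji|] := eqVneq j i => /=; last by rewrite !mul1r.
  rewrite ji in jm *; rewrite acti //; case: (act true); last by rewrite !mul1r.
  by rewrite expr1 mulrACA mulrNN !mul1r.
apply: eq_bigr => c' _; apply: eq_bigr => p _; apply: eq_bigr => q _.
rewrite mxE; case: ifP => [|/negbT]; first by rewrite !mul0r.
rewrite !spin2_flip !inE /= negb_and negb_or => /orP[/negPf ->|/andP[/negPf -> /negPf ->]];
  by rewrite ?andbF !mul1r.
Qed.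

(** An unglued [i] can be flipped in copy [c] alone, so only the couplings of that copy appear. *)
Lemma moment_glued_unglued J m c i b :
  (forall c i j, 0 <= J c i j) ->
  (forall c, (J c)^T = J c) -> (forall c, J c i i = 0) ->
  (m <= i)%N -> b != (c, i) ->
  moment (glued J m) [:: (c, i); b] <=
  \sum_k 2 * J c i k * moment (glued J m) [:: (c, k); b].
Proof.
move=> J0 Jsym Jii mi bci.
apply: le_trans (@moment_glued_le J m (pred1 c) c i b J0 Jsym Jii _ _ _) _ => //=.
- by rewrite ltnNge mi.
- by apply: contra bci => /andP[/eqP <- /eqP <-]; case: (b).
rewrite (bigD1 c) //= [X in _ + X]big1 ?addr0; last first.
  by move=> c' /negPf ->; rewrite big1 // => k _; rewrite !mul0r.
apply: ler_sum => k _; rewrite eqxx mul1r.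
rewrite (@moment_perm _ _ _ _ [:: (c, i), (c, i) & [:: (c, k); b]]) ?moment_sqr //.
by apply/permP => P /=; congr (_ + _)%N; rewrite addnCA.
Qed.

(** Both copies of a glued [i] are flipped together, so both graphs contribute; the gluing then
    cancels the two leftover spins at [i]. *)
Lemma moment_glued_glued J m c i b :
  (forall c i j, 0 <= J c i j) ->
  (forall c, (J c)^T = J c) -> (forall c, J c i i = 0) ->
  (i < m)%N -> b.2 != i ->
  moment (glued J m) [:: (c, i); b] <=
  \sum_k 2 * J c i k * moment (glued J m) [:: (c, k); b] +
  \sum_k 2 * J (~~ c) i k * moment (glued J m) [:: (~~ c, k); b].
Proof.
move=> J0 Jsym Jii im bi.
apply: le_trans (@moment_glued_le J m predT c i b J0 Jsym Jii _ _ _) _ => //=.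
  by rewrite andbT.
have P c' k : moment (glued J m) [:: (c', i); (c', k); (c, i); b] =
    moment (glued J m) [:: (c', k); b].
  rewrite (@moment_perm _ _ _ _ [:: (c', i), (c, i) & [:: (c', k); b]]) ?moment_glued ?im //.
  by apply/permP => Q /=; congr (_ + _)%N; rewrite addnCA.
rewrite (bigD1 c) //= (bigD1 (~~ c)) /=; last by case: (c).
rewrite [X in _ + (_ + X)]big1 ?addr0; last by case: c {P} => -[].
by rewrite lerD // ler_sum // => k _; rewrite P mul1r.
Qed.

End Glued.

(** * Entrywise order and squared Frobenius norm of matrices *)

Section MatrixOrder.
Set Implicit Arguments.
Unset Strict Implicit.
Variables (R : realType).

Definition mxle p q (x y : 'M[R]_(p, q)) : Prop := forall i j, x i j <= y i j.

Lemma mxle_refl p q (x : 'M[R]_(p, q)) : mxle x x.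
Proof. by move=> i j. Qed.

Lemma mxle_trans p q (y x z : 'M[R]_(p, q)) : mxle x y -> mxle y z -> mxle x z.
Proof. by move=> xy yz i j; apply: le_trans (xy i j) (yz i j). Qed.

Lemma mxleD p q (x y x' y' : 'M[R]_(p, q)) :
  mxle x x' -> mxle y y' -> mxle (x + y) (x' + y').
Proof. by move=> xx' yy' i j; rewrite !mxE lerD. Qed.

Lemma mxleZ p q a (x y : 'M[R]_(p, q)) : 0 <= a -> mxle x y -> mxle (a *: x) (a *: y).
Proof. by move=> a0 xy i j; rewrite !mxE ler_wpM2l. Qed.

Lemma mxleM p q r (A : 'M[R]_(p, q)) (x y : 'M[R]_(q, r)) :
  mxle 0 A -> mxle x y -> mxle (A *m x) (A *m y).
Proof.
move=> A0 xy i j; rewrite !mxE; apply: ler_sum => k _.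
by rewrite ler_wpM2l //; have := A0 i k; rewrite mxE.
Qed.

Lemma mxleM0 p q r (A : 'M[R]_(p, q)) (x : 'M[R]_(q, r)) :
  mxle 0 A -> mxle 0 x -> mxle 0 (A *m x).
Proof. by move=> A0 x0; have := mxleM A0 x0; rewrite mulmx0. Qed.

Lemma mxleD0 p q (x y : 'M[R]_(p, q)) : mxle 0 x -> mxle 0 y -> mxle 0 (x + y).
Proof. by move=> x0 y0; have := mxleD x0 y0; rewrite addr0. Qed.

Definition sqfro p q (A : 'M[R]_(p, q)) : R := \sum_i \sum_j A i j ^+ 2.

Lemma sqfro_ge0 p q (A : 'M[R]_(p, q)) : 0 <= sqfro A.
Proof. by do 2!(apply: sumr_ge0 => ? _); exact: sqr_ge0. Qed.

(** Cauchy-Schwarz, by Lagrange's identity. *)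
Lemma sqr_sum_le (I : finType) (x y : I -> R) :
  (\sum_i x i * y i) ^+ 2 <= (\sum_i x i ^+ 2) * (\sum_i y i ^+ 2).
Proof.
have : 0 <= \sum_i \sum_j (x i * y j - x j * y i) ^+ 2.
  by do 2!(apply: sumr_ge0 => ? _); exact: sqr_ge0.
rewrite (_ : \sum_i _ = 2 * ((\sum_i x i ^+ 2) * (\sum_i y i ^+ 2)) - 2 * (\sum_i x i * y i) ^+ 2).
  by rewrite subr_ge0 ler_pM2l.
transitivity (\sum_i \sum_j (x i ^+ 2 * y j ^+ 2) + \sum_j \sum_i (x i ^+ 2 * y j ^+ 2)
   - 2 * \sum_i \sum_j ((x i * y i) * (x j * y j))).
  rewrite mulr_sumr -sumrN -!big_split /=; apply: eq_bigr => i _.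
  rewrite mulr_sumr -sumrN -!big_split /=; apply: eq_bigr => j _; ring.
rewrite [X in _ + X - _]exchange_big /= expr2 !big_distrlr /=; ring.
Qed.

Lemma sqfro_mulmx p q r (A : 'M[R]_(p, q)) (x : 'M[R]_(q, r)) :
  sqfro (A *m x) <= sqfro A * sqfro x.
Proof.
rewrite /sqfro [\sum_(i < q) _]exchange_big /= mulr_suml; apply: ler_sum => i _.
rewrite mulr_sumr; apply: ler_sum => j _.
by rewrite mxE; exact: sqr_sum_le.
Qed.

Lemma sqfroD p q (A B : 'M[R]_(p, q)) : sqfro (A + B) <= 2 * sqfro A + 2 * sqfro B.
Proof.
rewrite /sqfro !mulr_sumr -big_split; apply: ler_sum => i _.
rewrite /= !mulr_sumr -big_split; apply: ler_sum => j _; rewrite mxE /=.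
by have := sqr_ge0 (A i j - B i j); rewrite -subr_ge0; lra.
Qed.

Lemma sqfroZ p q a (A : 'M[R]_(p, q)) : sqfro (a *: A) = a ^+ 2 * sqfro A.
Proof.
rewrite /sqfro mulr_sumr; apply: eq_bigr => i _; rewrite mulr_sumr.
by apply: eq_bigr => j _; rewrite mxE exprMn.
Qed.

Lemma sqfro_le p q (A B : 'M[R]_(p, q)) : mxle 0 A -> mxle A B -> sqfro A <= sqfro B.
Proof.
move=> A0 AB; apply: ler_sum => i _; apply: ler_sum => j _.
have := A0 i j; rewrite mxE => Aij.
by rewrite ler_sqr ?nnegrE // (le_trans Aij).
Qed.

Lemma sqr_entry_le_sqfro p q (A : 'M[R]_(p, q)) i j : A i j ^+ 2 <= sqfro A.
Proof.
rewrite /sqfro (bigD1 i) //= (bigD1 j) //= -addrA lerDl addr_ge0 //.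
  by apply: sumr_ge0 => k _; exact: sqr_ge0.
by do 2!(apply: sumr_ge0 => ? _); exact: sqr_ge0.
Qed.

Lemma sqfro_delta d (m : 'I_d) : sqfro (delta_mx m 0 : 'cV[R]_d) = 1.
Proof.
rewrite /sqfro (bigD1 m) //= big_ord1 mxE !eqxx expr1n big1 ?addr0 // => i im.
by rewrite big_ord1 mxE (negPf im) expr0n.
Qed.

End MatrixOrder.

(** * Walk sums generated by two nonnegative matrices *)

Section Walks.
Set Implicit Arguments.
Unset Strict Implicit.
Variables (R : realType) (d : nat) (A B : 'M[R]_d) (b : R) (v u : 'cV[R]_d) (m : 'I_d).
(** A mask that keeps the coordinates below [m], which will be the glued vertices. *)
Let P : 'M[R]_d := diag_mx (\row_k ((k < m)%N)%:R).
Let delta : 'cV[R]_d := delta_mx m 0.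
Hypotheses (A0 : mxle 0 A) (B0 : mxle 0 B) (b0 : 0 <= b).
Hypotheses (v0 : mxle 0 v) (u0 : mxle 0 u).
Hypothesis vle : mxle v (b *: (A *m v + P *m (B *m delta) + P *m (B *m u))).
Hypothesis ule : mxle u (b *: (B *m delta + B *m u + P *m (A *m v))).

(** With the masks dropped, [b *: g] dominates both [v] and [u], so this one vector controls all
    long walks. *)
Let g := A *m v + B *m delta + B *m u.

Let P0 : mxle 0 P.
Proof.
by move=> i j; rewrite !mxE; case: (i == j) => //; rewrite ?mulr0n ?mulr1n.
Qed.

Let Pv_le (x : 'cV[R]_d) : mxle 0 x -> mxle (P *m x) x.
Proof.
move=> x0 i j; rewrite mul_diag_mx !mxE; have := x0 i j; rewrite mxE => x0'.
by case: (_ < _)%N; rewrite ?mul1r ?mul0r.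
Qed.

Let delta0 : mxle 0 delta.
Proof. by move=> i j; rewrite !mxE. Qed.

Let v_le : mxle v (b *: g).
Proof.
apply: mxle_trans vle _; apply: mxleZ => //.
by do !apply: mxleD; first exact: mxle_refl; apply: Pv_le; apply: mxleM0.
Qed.

Let u_le : mxle u (b *: g).
Proof.
apply: mxle_trans ule _; apply: mxleZ => //; rewrite /g addrC addrA.
by do !apply: mxleD; [|exact: mxle_refl..]; apply: Pv_le; apply: mxleM0.
Qed.

Lemma walk_g0 : mxle 0 g.
Proof. by rewrite /g; do !apply: mxleD0; apply: mxleM0. Qed.

(** Inserting the bounds of [v] and [u] by [b *: g] into [g] itself gives a self-bounding
    inequality, which replaces summing the infinite series of walks. *)
Lemma walk_g_le : mxle g (B *m delta + b *: ((A + B) *m g)).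
Proof.
rewrite {1}/g addrAC [X in mxle X _]addrC; apply: mxleD; first exact: mxle_refl.
rewrite scalemxAr mulmxDl.
by apply: mxleD; apply: mxleM.
Qed.

(* Three substitutions of [vle] and [ule] in [v m], keeping the masks [P] in the
   terms that end in [delta] and dropping them in all the others. *)
Lemma walk_expansion :
  v m 0 <= b ^+ 2 * \sum_(k < d | (k < m)%N) A m k * B k m
    + b ^+ 3 * (\sum_(k < d | (k < m)%N) A m k * (B *m B) k m
                + \sum_(k < d | (k < m)%N) (A *m A) m k * B k m)
    + b ^+ 4 * (A *m ((A + B) *m ((A + B) *m g))) m 0.
Proof.
have PB (C D : 'M[R]_d) : (C *m (P *m (D *m delta))) m 0 =
    \sum_(k < d | (k < m)%N) C m k * D k m.
  rewrite mxE [RHS]big_mkcond /=; apply: eq_bigr => k _.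
  rewrite mul_diag_mx 2!mxE -colE mxE.
  by case: (_ < _)%N; rewrite ?mul1r ?mul0r ?mulr0.
have Am C (x y : 'cV[R]_d) : mxle 0 C -> mxle x y -> (C *m x) m 0 <= (C *m y) m 0.
  by move=> C0 xy; apply: mxleM.
have DE (x y : 'cV[R]_d) : (x + y) m 0 = x m 0 + y m 0 by rewrite mxE.
have ZE (x : 'cV[R]_d) : (b *: x) m 0 = b * x m 0 by rewrite mxE.
(* At coordinate [m] the masked terms vanish, [m] itself not being glued yet. *)
have vm : v m 0 <= b * (A *m v) m 0.
  apply: le_trans (vle m 0) _; rewrite ZE ler_wpM2l // !DE.
  have Pm x : (P *m x : 'cV[R]_d) m 0 = 0 by rewrite mul_diag_mx 2!mxE ltnn mul0r.
  by rewrite !Pm !addr0.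
have AA0 : mxle 0 (A *m A) by apply: mxleM0.
have AP0 : mxle 0 (A *m P *m B) by do !apply: mxleM0.
set rest := (A *m ((A + B) *m ((A + B) *m g))) m 0.
have := Am _ _ _ A0 vle; have := Am _ _ _ AA0 vle; have := Am _ _ _ AP0 ule.
rewrite -!scalemxAr !mulmxDr !ZE !DE -!mulmxA !PB.
rewrite !(mulmxA A A) (mulmxA B B) !PB.
(* These are the terms ending in [v] or [u]. Without masks they add up to at most [A], then [A + B],
   applied to [A *m v + B *m u]; bounding [v] and [u] by [b *: g] costs the factor [b]. *)
have r1 : (A *m (A *m A *m v)) m 0 + (A *m A *m (P *m (B *m u))) m 0 +
   ((A *m (P *m (B *m (B *m u)))) m 0 + (A *m (P *m (B *m (P *m (A *m v))))) m 0)
   <= b * rest.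
  apply: (@le_trans _ _ ((A *m ((A + B) *m (A *m v + B *m u))) m 0)); last first.
    rewrite /rest -ZE; do 2!rewrite scalemxAr; apply: Am => //.
    apply: mxleM; first exact: mxleD0.
    by rewrite scalemxAr mulmxDl; apply: mxleD; apply: mxleM.
  have Bu0 : mxle 0 (B *m u) by apply: mxleM0.
  have Av0 : mxle 0 (A *m v) by apply: mxleM0.
  have -> : (A *m ((A + B) *m (A *m v + B *m u))) m 0 =
     (A *m (A *m A *m v)) m 0 + (A *m A *m (B *m u)) m 0 +
     ((A *m (B *m (B *m u))) m 0 + (A *m (B *m (A *m v))) m 0).
    by rewrite mulmxDl !mulmxDr !DE -!mulmxA; ring.
  apply: lerD; last apply: lerD.
  - by rewrite lerD2l; apply: Am => //; exact: Pv_le.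
  - by apply: Am => //; apply: Pv_le; apply: mxleM0.
  - apply: Am => //; apply: mxle_trans (Pv_le _) _; first by do !apply: mxleM0.
    by apply: mxleM => //; exact: Pv_le.
move: r1 vm; set c1 := (A *m (A *m A *m v)) m 0; set c2 := (A *m A *m (P *m _)) m 0.
set c3 := (A *m (P *m (B *m (B *m u)))) m 0; set c4 := (A *m (P *m (B *m (P *m _)))) m 0.
set X := (A *m v) m 0; set Y := (A *m A *m v) m 0; set Z := (A *m _) m 0.
set t1 := \sum_(k < d | _) _; set t2 := \sum_(k < d | _) _; set t3 := \sum_(k < d | _) _.
move=> r1 vX Zle Yle Xle.
have YZ : Y + Z <= b * (t1 + t2 + b * rest).
  apply: le_trans (lerD Yle Zle) _; rewrite -mulrDr ler_wpM2l //; lra.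
have Xle' : X <= b * (t3 + b * (t1 + t2 + b * rest)).
  apply: le_trans Xle _; rewrite ler_wpM2l //; lra.
apply: le_trans vX _; apply: le_trans (ler_wpM2l b0 Xle') _.
rewrite le_eqVlt; apply/orP; left; apply/eqP; ring.
Qed.

(** The condition on [b] makes the feedback term of [walk_g_le] at most half of [sqfro g], whence
    [sqfro g <= 4 * l]. Each [A + B] then costs [4 * l] and [A] costs [l], and 8 is the square root
    of 64. *)
Lemma walk_frobenius (l : R) : sqfro A <= l -> sqfro B <= l -> b ^+ 2 * l <= 1 / 16 ->
  (A *m ((A + B) *m ((A + B) *m g))) m 0 <= 8 * l ^+ 2.
Proof.
move=> Al Bl bl.
have l0 : 0 <= l by apply: le_trans (sqfro_ge0 A) Al.
have AB : sqfro (A + B) <= 4 * l by apply: le_trans (sqfroD A B) _; lra.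
have ABx (x : 'cV[R]_d) : sqfro ((A + B) *m x) <= 4 * l * sqfro x.
  by apply: le_trans (sqfro_mulmx _ _) _; rewrite ler_wpM2r ?sqfro_ge0.
have gl : sqfro g <= 4 * l.
  have : sqfro g <= 2 * l + b ^+ 2 * l * (8 * sqfro g).
    apply: le_trans (sqfro_le walk_g0 walk_g_le) _; apply: le_trans (sqfroD _ _) _.
    apply: lerD; first rewrite ler_pM2l //.
      by apply: le_trans (sqfro_mulmx _ _) _; rewrite sqfro_delta mulr1.
    rewrite sqfroZ (_ : _ * (8 * _) = 2 * (b ^+ 2 * (4 * l * sqfro g))); last by ring.
    by rewrite ler_pM2l // ler_wpM2l ?sqr_ge0.
  have : b ^+ 2 * l * (8 * sqfro g) <= 1 / 16 * (8 * sqfro g).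
    by rewrite ler_wpM2r // mulr_ge0 // sqfro_ge0.
  lra.
have r0 : 0 <= (A *m ((A + B) *m ((A + B) *m g))) m 0.
  have : mxle 0 (A *m ((A + B) *m ((A + B) *m g))).
    by do !apply: mxleM0 => //; try exact: mxleD0; exact: walk_g0.
  by move/(_ m 0); rewrite mxE.
rewrite -ler_sqr ?nnegrE //; last by rewrite mulr_ge0 // sqr_ge0.
apply: le_trans (sqr_entry_le_sqfro _ _ _) _; apply: le_trans (sqfro_mulmx _ _) _.
have h : sqfro ((A + B) *m ((A + B) *m g)) <= 4 * l * (4 * l * (4 * l)).
  apply: le_trans (ABx _) _; rewrite ler_wpM2l //; first lra.
  by apply: le_trans (ABx _) _; rewrite ler_wpM2l //; lra.
rewrite (_ : (8 * l ^+ 2) ^+ 2 = l * (4 * l * (4 * l * (4 * l)))); last by ring.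
by apply: ler_pM => //; exact: sqfro_ge0.
Qed.

Lemma mulmx_entry_le (C : 'M[R]_d) (x : 'cV[R]_d) (gam mu : R) i :
  mxle 0 C -> 0 <= mu -> \sum_j C i j <= gam -> (forall j, x j 0 <= mu) ->
  (C *m x) i 0 <= gam * mu.
Proof.
move=> C0 mu0 Cg xmu; rewrite mxE; apply: (@le_trans _ _ (\sum_j C i j * mu)).
  by apply: ler_sum => j _; rewrite ler_wpM2l //; have := C0 i j; rewrite mxE.
by rewrite -mulr_suml ler_wpM2r.
Qed.

(** The same absorption in the supremum norm gives [h <= 4 * gam]. The first two steps of the walk
    end at one of at most [V] vertices, each reached in at most [gam] ways; the choice of [A] or [B]
    for the second step doubles the bound. *)
Lemma walk_degree (gam V : R) (SA SB : {set 'I_d}) :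
  (forall i j, A i j <= 1) -> (forall i j, B i j <= 1) ->
  (forall i, \sum_j A i j <= gam) -> (forall i, \sum_j B i j <= gam) ->
  (forall i j, j \notin SA -> A i j = 0) -> (forall i j, j \notin SB -> B i j = 0) ->
  #|SA|%:R <= V -> #|SB|%:R <= V -> b * gam <= 1 / 4 ->
  (A *m ((A + B) *m ((A + B) *m g))) m 0 <= 8 * (V * gam ^+ 2).
Proof.
move=> A1 B1 Ag Bg SA0 SB0 SAV SBV bg.
have A0' i j : 0 <= A i j by have := A0 i j; rewrite mxE.
have B0' i j : 0 <= B i j by have := B0 i j; rewrite mxE.
have gam0 : 0 <= gam by apply: le_trans (Ag m); apply: sumr_ge0.
have AB0 : mxle 0 (A + B) by exact: mxleD0.
have ABg i : \sum_j (A + B) i j <= 2 * gam.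
  rewrite (eq_bigr (fun j => A i j + B i j)); last by move=> j _; rewrite mxE.
  by rewrite big_split /=; have := Ag i; have := Bg i; lra.
pose h := (A + B) *m g.
have h0 : mxle 0 h by apply: mxleM0 => //; exact: walk_g0.
have hle : mxle h ((A + B) *m (B *m delta) + b *: ((A + B) *m h)).
  by rewrite scalemxAr -mulmxDr; apply: mxleM => //; exact: walk_g_le.
have hmu i : h i 0 <= 4 * gam.
  (* Where [h] is largest, [hle] bounds it by [2 * gam] plus half of itself. *)
  pose k := [arg max_(k > m) h k 0]%O.
  have hk j : h j 0 <= h k 0 by rewrite /k; case: arg_maxP => // k' _; apply.
  apply: le_trans (hk i) _.
  have hk0 : 0 <= h k 0 by have := h0 k 0; rewrite mxE.
  have : h k 0 <= 2 * gam * 1 + b * (2 * gam * h k 0).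
    apply: le_trans (hle k 0) _; rewrite mxE [X in _ + X]mxE; apply: lerD.
      by apply: mulmx_entry_le => // j; rewrite -colE mxE.
    by rewrite ler_wpM2l // mulmx_entry_le.
  have : b * gam * (2 * h k 0) <= 1 / 4 * (2 * h k 0).
    by rewrite ler_wpM2r // mulr_ge0.
  lra.
have bound (C : 'M[R]_d) (SC : {set 'I_d}) : mxle 0 C -> (forall i j, C i j <= 1) ->
    (forall i j, j \notin SC -> C i j = 0) -> #|SC|%:R <= V ->
    (A *m C *m h) m 0 <= 4 * (V * gam ^+ 2).
  move=> C0 C1 SC0 SCV.
  rewrite mxE (bigID (mem SC)) /= [X in _ + X]big1 ?addr0; last first.
    move=> p pS; rewrite mxE big1 ?mul0r // => k _; by rewrite SC0 ?mulr0.
  apply: (@le_trans _ _ (\sum_(p in SC) gam * (4 * gam))).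
    apply: ler_sum => p _; apply: ler_pM => //.
    - by rewrite mxE; apply: sumr_ge0 => k _; rewrite mulr_ge0 //; have := C0 k p; rewrite mxE.
    - by have := h0 p 0; rewrite mxE.
    rewrite mxE; apply: le_trans (Ag m); apply: ler_sum => k _.
    by rewrite ler_piMr.
  rewrite sumr_const -[X in X <= _]mulr_natl (_ : 4 * (V * _) = V * (gam * (4 * gam))); last by ring.
  by rewrite ler_wpM2r // !mulr_ge0.
have := bound _ _ A0 A1 SA0 SAV; have := bound _ _ B0 B1 SB0 SBV.
by rewrite -/h; move: (h) => x Bx Ax; rewrite mulmxDl mulmxDr !mulmxA mxE; lra.
Qed.

End Walks.

(** * Adjacency matrices and arboricity *)

Section Graphs.
Set Implicit Arguments.
Unset Strict Implicit.
Variables (R : realType) (d : nat).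
Implicit Types (G : sgraph d) (S : {set 'I_d}).

Lemma adj_sym G i j : adj G i j = adj G j i.
Proof. by rewrite /adj finset.setUC. Qed.

Lemma card_edge G e : e \in edges G -> #|e| = 2.
Proof. by move=> eG; apply/eqP; have /forall_inP := valP G; apply. Qed.

Lemma adj_irr G i : adj G i i = false.
Proof.
by apply/negP => /card_edge; rewrite finset.setUid cards1.
Qed.

Lemma adjmx_sym G : (adjmx R G)^T = adjmx R G.
Proof. by apply/matrixP => i j; rewrite !mxE adj_sym. Qed.

Lemma adjmxC G i j : adjmx R G i j = adjmx R G j i.
Proof. by rewrite !mxE adj_sym. Qed.

Lemma adjmx_ii G i : adjmx R G i i = 0.
Proof. by rewrite mxE adj_irr. Qed.

Lemma adjmx_ge0 G i j : 0 <= adjmx R G i j.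
Proof. by rewrite mxE ler0n. Qed.

Lemma adjmx_le1 G i j : adjmx R G i j <= 1.
Proof. by rewrite mxE lern1; case: adj. Qed.

Lemma adjmx_vertices G i j : j \notin vertices G -> adjmx R G i j = 0.
Proof.
by rewrite inE negb_exists => /forallP/(_ i); rewrite mxE adj_sym => /negPf ->.
Qed.

(** A set of at most one vertex spans no edge, so the degenerate denominators are harmless;
    otherwise [#|S| - 1] is weakened to [#|S|]. *)
Lemma num_edges_in_le G S : (num_edges_in G S <= arboricity G * #|S|)%N.
Proof.
have [S1|S1] := leqP #|S| 1.
  suff -> : num_edges_in G S = 0%N by [].
  apply/eqP; rewrite cards_eq0; apply/eqP/setP => e; rewrite !inE.
  apply/negP => /andP[/card_edge e2 /subset_leq_card]; rewrite e2.
  by move=> /leq_trans/(_ S1).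
apply: (@leq_trans (arboricity G * (#|S| - 1))); last by rewrite leq_mul2l leq_subr orbT.
have S0 : 0 < #|S|%:R - 1 :> rat by rewrite subr_gt0 ltr1n.
rewrite -(@ler_nat rat) natrM natrB 1?ltnW // -ler_pdivrMr // /arboricity.
set M := \big[_/_]_V _.
have rM : (num_edges_in G S)%:R / (#|S|%:R - 1) <= M :> rat.
  exact: (le_bigmax _ (fun V : {set 'I_d} => (num_edges_in G V)%:R / (#|V|%:R - 1) : rat)).
apply: le_trans rM _; apply: le_trans (ceil_ge M) _.
by rewrite natr_absz ler_int ler_norm.
Qed.

(** The order [k < m] makes the map from pairs to edges injective, so each edge is counted once. *)
Lemma sum_adj_le G S :
  \sum_(m in S) \sum_(k < d | (k < m)%N && (k \in S)) adjmx R G m k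
  <= (num_edges_in G S)%:R.
Proof.
rewrite pair_big_dep /=.
rewrite (eq_bigr (fun p => if adj G p.1 p.2 then 1 else 0)); last first.
  by move=> p _; rewrite mxE; case: adj.
rewrite -big_mkcondr /= sumr_const ler_nat.
set D := (X in #|X|).
have : {in D &, injective (fun p : 'I_d * 'I_d => [set p.1; p.2]%SET)}.
  move=> [m k] [m' k']; rewrite -!topredE /= =>
    /andP[/and3P[_ km _] _] /andP[/and3P[_ km' _] _] E; rewrite /= in km km'.
  have := finset.set21 m k; rewrite E; have := finset.set22 m k; rewrite E.
  rewrite !inE => /orP[]/eqP ek /orP[]/eqP em; subst => //; lia.
move/card_in_imset <-; apply: subset_leq_card; apply/fintype.subsetP => e.
move=> /imsetP[[m k]]; rewrite -topredE /= => /andP[/and3P[mS _ kS] mk] ->.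
rewrite /= in mS kS mk; rewrite inE -/(adj G m k) mk /=.
apply/fintype.subsetP => x; rewrite !inE => /orP[]/eqP -> //.
Qed.

End Graphs.

(** * Walks of length three, with one step in one graph and two in the other *)

Section TriangleSum.
Set Implicit Arguments.
Unset Strict Implicit.
Variables (R : realType) (d : nat) (G G' : sgraph d).
Let A := adjmx R G.
Let B := adjmx R G'.
Let S := (vertices G :&: vertices G')%SET.

(** A nonzero term has [k] adjacent to some vertex in each of the two graphs. *)
Lemma triangle_sum_restrict (m : 'I_d) :
  \sum_(k < d | (k < m)%N) A m k * (B *m B) k m =
  \sum_(k < d | (k < m)%N && (k \in S)) A m k * (B *m B) k m.
Proof.
rewrite (bigID (mem S)) /= [X in _ + X]big1 ?addr0 // => k /andP[_].
rewrite inE negb_and => /orP[kG|kG']; first by rewrite /A adjmx_vertices ?mul0r.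
by rewrite [(B *m B) _ _]mxE [X in _ * X]big1 ?mulr0 // => j _; rewrite /B adjmxC adjmx_vertices ?mul0r.
Qed.

Lemma triangle_sum_degree (gam : R) : (forall i, \sum_j B i j <= gam) ->
  \sum_(m in S) \sum_(k < d | (k < m)%N) A m k * (B *m B) k m <=
  gam * \sum_(m in S) \sum_(k < d | (k < m)%N && (k \in S)) A m k.
Proof.
move=> Bg; rewrite mulr_sumr; apply: ler_sum => m _; rewrite triangle_sum_restrict mulr_sumr.
apply: ler_sum => k _; rewrite mulrC ler_wpM2r ?adjmx_ge0 //.
rewrite mxE; apply: le_trans (Bg k); apply: ler_sum => j _.
by rewrite ler_piMr ?adjmx_ge0 ?adjmx_le1.
Qed.

(** Bounding [A m k] by 1 leaves the quadratic form of [B *m B] at the indicator [x] of [S], that is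
    the squared norm of [B *m x]. *)
Lemma triangle_sum_frobenius :
  \sum_(m in S) \sum_(k < d | (k < m)%N) A m k * (B *m B) k m <= sqfro B * #|S|%:R.
Proof.
pose x : 'cV[R]_d := \col_i (i \in S)%:R.
have BB0 k m : 0 <= (B *m B) k m.
  by rewrite mxE sumr_ge0 // => j _; rewrite mulr_ge0 ?adjmx_ge0.
have <- : sqfro x = #|S|%:R.
  rewrite /sqfro -sum1_card natr_sum [RHS]big_mkcond /=; apply: eq_bigr => i _.
  by rewrite big_ord1 mxE; case: (i \in S); rewrite ?expr1n ?expr0n.
apply: le_trans (sqfro_mulmx B x).
have -> : sqfro (B *m x) = \sum_(m in S) \sum_(k in S) (B *m B) k m.
  transitivity (\sum_j (\sum_(k in S) B k j) * (\sum_(m in S) B j m)).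
    apply: eq_bigr => j _; rewrite big_ord1 expr2 mxE.
    have -> : \sum_i B j i * x i 0 = \sum_(m in S) B j m.
      rewrite [RHS]big_mkcond /=; apply: eq_bigr => i _.
      by rewrite [x _ _]mxE; case: (i \in S); rewrite ?mulr1 ?mulr0.
    by congr (_ * _); apply: eq_bigr => k _; rewrite /B adjmxC.
  under eq_bigr do rewrite big_distrlr /=.
  rewrite exchange_big /= [RHS]exchange_big; apply: eq_bigr => k _.
  by rewrite exchange_big /=; apply: eq_bigr => m _; rewrite mxE.
apply: ler_sum => m _; rewrite triangle_sum_restrict big_mkcondl /=; apply: ler_sum => k _.
by case: ifP => // _; rewrite ler_piMl ?adjmx_le1.
Qed.

(** The alternatives are the two branches of a minimum. In the second, the edge count [E] is at most
    [r * #|S|] by arboricity and at most [#|S| * V] trivially; multiplying both bounds produces the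
    factor [r * V] in [E ^+ 2]. *)
Lemma triangle_sum_le (theta l gam : R) (V r : nat) :
  0 <= theta -> (0 < r)%N ->
  arboricity G = r -> sqfro B <= l -> (forall i, \sum_j B i j <= gam) ->
  (#|vertices G| <= V)%N ->
  theta ^+ 2 * (512 * l ^+ 2) <= r%:R \/ theta ^+ 2 * (512 * (V%:R * gam ^+ 2)) <= r%:R ->
  theta * \sum_(m in S) \sum_(k < d | (k < m)%N) A m k * (B *m B) k m
    <= 3 / 64 * (r%:R * #|S|%:R).
Proof.
move=> t0 r0 Gr Bl Bg GV cases.
have r1 : 1 <= r%:R :> R by rewrite ler1n.
have rS0 : 0 <= r%:R * #|S|%:R :> R by rewrite -natrM.
(* 3 / 64 is slightly more than 1 / sqrt 512. *)
have sqr_le (x y : R) : 0 <= y -> x ^+ 2 * 512 <= y ^+ 2 -> x <= 3 / 64 * y.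
  move=> y0 xy; case: (leP 0 x) => x0; last by apply: (le_trans (ltW x0)); rewrite mulr_ge0.
  rewrite -ler_sqr ?nnegrE ?mulr_ge0 // exprMn.
  have := sqr_ge0 y; rewrite (_ : (3 / 64) ^+ 2 = 9 / 4096 :> R); [lra | by field].
case: cases => [cl|cg].
  have l0 : 0 <= l by apply: le_trans (sqfro_ge0 _) Bl.
  apply: (@le_trans _ _ (theta * l * #|S|%:R)).
    rewrite -mulrA ler_wpM2l //; apply: le_trans triangle_sum_frobenius _.
    by rewrite ler_wpM2r.
  rewrite !mulrA ler_wpM2r //; apply: sqr_le => //.
  rewrite (_ : _ * 512 = theta ^+ 2 * (512 * l ^+ 2)); last by ring.
  (* Here [r <= r ^+ 2], because [r] is a positive integer. *)
  by apply: le_trans cl _; rewrite expr2 ler_peMr.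
have [m mS|S0] := pickP (mem S); last first.
  by rewrite big_pred0 // mulr0 mulr_ge0.
have gam0 : 0 <= gam by apply: le_trans (Bg m); apply: sumr_ge0 => j _; exact: adjmx_ge0.
apply: le_trans (ler_wpM2l t0 (triangle_sum_degree Bg)) _.
set E := \sum_(m in S) _.
have E0 : 0 <= E by do 2!(apply: sumr_ge0 => ? _); exact: adjmx_ge0.
have E1 : E <= r%:R * #|S|%:R.
  by apply: le_trans (sum_adj_le _ _ _) _; rewrite -natrM ler_nat -Gr num_edges_in_le.
have E2 : E <= #|S|%:R * V%:R.
  apply: (@le_trans _ _ (\sum_(m in S) V%:R)); last by rewrite sumr_const -[_ *+ #|_|]mulr_natl.
  apply: ler_sum => i _; apply: (@le_trans _ _ (\sum_(k in S) 1)).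
    rewrite big_mkcondl /=; apply: ler_sum => k _; case: ifP => // _; exact: adjmx_le1.
  rewrite sumr_const ler_nat; apply: leq_trans GV; apply: subset_leq_card.
  exact: finset.subsetIl.
apply: sqr_le => //.
have EE : E ^+ 2 <= r%:R * #|S|%:R * (#|S|%:R * V%:R) by rewrite expr2 ler_pM.
rewrite (_ : _ * 512 = theta ^+ 2 * 512 * gam ^+ 2 * E ^+ 2); last by ring.
apply: (@le_trans _ _ (theta ^+ 2 * 512 * gam ^+ 2 * (r%:R * #|S|%:R * (#|S|%:R * V%:R)))).
  apply: ler_wpM2l EE; apply: mulr_ge0; last exact: sqr_ge0.
  by apply: mulr_ge0; [exact: sqr_ge0 | exact: ler0n].
rewrite (_ : _ * (_ * _) = (r%:R * #|S|%:R ^+ 2) * (theta ^+ 2 * (512 * (V%:R * gam ^+ 2)))); last by ring.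
rewrite (_ : (_ * _) ^+ 2 = r%:R * #|S|%:R ^+ 2 * r%:R); last by ring.
by rewrite ler_wpM2l // mulr_ge0 ?sqr_ge0.
Qed.

End TriangleSum.

(** * Overlap of the likelihood ratios of two graphs *)

Section ChiSquare.
Set Implicit Arguments.
Unset Strict Implicit.
Variables (R : realType) (d : nat) (G G' : sgraph d) (theta : R).
Hypothesis theta_ge0 : 0 <= theta.
Let A := adjmx R G.
Let B := adjmx R G'.
Let S := (vertices G :&: vertices G')%SET.
Let J (c : bool) : 'M[R]_d := theta *: (if c then B else A).
(** The total mass interpolates between the product of the partition functions at [k = 0] and the
    unnormalised overlap at [k = d]. *)
Let Z k := moment (glued J k) [::].

Let J0 c i j : 0 <= J c i j.
Proof. by rewrite mxE mulr_ge0 //; case: c; exact: adjmx_ge0. Qed.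

Let Jsym c : (J c)^T = J c.
Proof. by rewrite /J linearZ /=; case: c; rewrite adjmx_sym. Qed.

Let Jii c i : J c i i = 0.
Proof. by rewrite mxE; case: c; rewrite adjmx_ii mulr0. Qed.

Let gluing_ge0 k (w : config d * config d) : 0 <= gluing R k w.
Proof.
apply: prodr_ge0 => i _.
by have [->|->] := spin2_cases R (false, i) w; have [->|->] := spin2_cases R (true, i) w; lra.
Qed.

Lemma glued_total_gt0 k : 0 < Z k.
Proof.
pose w0 : config d * config d := ([ffun=> true], [ffun=> true]).
rewrite /Z /moment (bigD1 w0) //= ltr_pwDl //; last first.
  by apply: sumr_ge0 => w _; rewrite big_nil mulr1; apply: mulr_ge0; [exact: gluing_ge0 | exact: expR_ge0].
rewrite big_nil mulr1; apply: mulr_gt0; last exact: expR_gt0.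
apply: prodr_gt0 => i _.
by rewrite /spin2 /spin !ffunE; lra.
Qed.

Section Step.
Variable m : 'I_d.

Let corr (a : bool * 'I_d) : R := moment (glued J m) [:: a; (true, m)] / Z m.
(* [v] and [u] are the correlations of [y_m] with the [x_k] and the [y_k]; the
   trivial correlation <y_m y_m> = 1 is split off from [u] as [delta]. *)
Let v : 'cV[R]_d := \col_k corr (false, k).
Let u : 'cV[R]_d := \col_k (if k == m then 0 else corr (true, k)).
Let P : 'M[R]_d := diag_mx (\row_k ((k < m)%N)%:R).
Let delta : 'cV[R]_d := delta_mx m 0.
Let b := 2 * theta.

Let corr_ge0 a : 0 <= corr a.
Proof. by rewrite divr_ge0 ?griffiths_glued // ltW // glued_total_gt0. Qed.

Let corr_m : corr (true, m) = 1.
Proof. by rewrite /corr moment_sqr divff // gt_eqF // glued_total_gt0. Qed.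

Let v0 : mxle 0 v.
Proof. by move=> i j; rewrite !mxE. Qed.

Let u0 : mxle 0 u.
Proof. by move=> i j; rewrite !mxE; case: ifP. Qed.

Let Av i : (A *m v) i 0 = \sum_k A i k * corr (false, k).
Proof. by rewrite mxE; apply: eq_bigr => k _; rewrite [v _ _]mxE. Qed.

Let Bw i : (B *m delta) i 0 + (B *m u) i 0 = \sum_k B i k * corr (true, k).
Proof.
rewrite -colE [col _ _ _ _]mxE [RHS](bigD1 m) //= corr_m mulr1; congr (_ + _).
rewrite mxE (bigD1 m) //= [u m 0]mxE eqxx mulr0 add0r.
by apply: eq_bigr => k /negPf km; rewrite [u _ _]mxE km.
Qed.

Let sumJ c i c' : (\sum_k 2 * J c i k * moment (glued J m) [:: (c', k); (true, m)]) / Z m =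
  b * \sum_k (if c then B else A) i k * corr (c', k).
Proof.
rewrite mulr_suml mulr_sumr; apply: eq_bigr => k _.
by rewrite [J _ _ _]mxE /corr /b; ring.
Qed.

Let DE (x y : 'cV[R]_d) i : (x + y) i 0 = x i 0 + y i 0.
Proof. by rewrite mxE. Qed.

Let PE (x : 'cV[R]_d) (i : 'I_d) : (P *m x) i 0 = ((i < m)%N)%:R * x i 0.
Proof. by rewrite mul_diag_mx 2!mxE. Qed.

Let corr_unglued c (i : 'I_d) : (m <= i)%N -> (c, i) != (true, m) ->
  corr (c, i) <= b * \sum_k (if c then B else A) i k * corr (c, k).
Proof.
move=> mi im; rewrite -sumJ; apply: ler_wpM2r.
  by rewrite invr_ge0 ltW // glued_total_gt0.
by apply: moment_glued_unglued => //; rewrite eq_sym.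
Qed.

Let corr_glued c (i : 'I_d) : (i < m)%N ->
  corr (c, i) <= b * \sum_k A i k * corr (false, k) + b * \sum_k B i k * corr (true, k).
Proof.
move=> im.
have mi : m != i by rewrite neq_ltn im orbT.
have := @moment_glued_glued R d J m c i (true, m) J0 Jsym (fun c => Jii c i) im mi.
rewrite -(@ler_pM2r _ (Z m)^-1) ?invr_gt0 ?glued_total_gt0 // mulrDl !sumJ.
by case: c => //= /le_trans; apply; rewrite addrC.
Qed.

(** Fisher's bound in matrix form: the mask [P] expresses that the other graph enters only at glued
    vertices. *)
Lemma correlation_walks : mxle v (b *: (A *m v + P *m (B *m delta) + P *m (B *m u))).
Proof.
move=> k j; rewrite (ord1 j) [v _ _]mxE [X in _ <= X]mxE.
rewrite !DE !PE Av.
rewrite -addrA -mulrDr Bw; have [km|mk] := ltnP k m.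
  by rewrite mul1r mulrDr; exact: corr_glued.
by rewrite mul0r addr0; apply: (@corr_unglued false).
Qed.

Lemma correlation_walks' : mxle u (b *: (B *m delta + B *m u + P *m (A *m v))).
Proof.
move=> k j; rewrite (ord1 j) [u _ _]mxE [X in _ <= X]mxE.
rewrite !DE !PE Av Bw.
have pos (C : 'M[R]_d) c : (forall i j, 0 <= C i j) -> 0 <= \sum_j C k j * corr (c, j).
  by move=> C0; apply: sumr_ge0 => i _; rewrite mulr_ge0.
have [->|km] := eqVneq k m.
  rewrite ltnn mul0r addr0 mulr_ge0 //; first by rewrite mulr_ge0.
  by apply: sumr_ge0 => i _; rewrite mulr_ge0 //; exact: adjmx_ge0.
have [lkm|mk] := ltnP k m.
  by rewrite mul1r mulrDr addrC; exact: corr_glued.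
by rewrite mul0r addr0; apply: (@corr_unglued true).
Qed.

(** At stage [m] the vertex [m] is unglued, so Fisher's bound applies to its copy in a graph where
    it is isolated, and all terms vanish. *)
Lemma corr_notin : m \notin S -> corr (false, m) <= 0.
Proof.
rewrite inE negb_and => /orP[mG|mG'].
  apply: le_trans (@corr_unglued false m _ _) _ => //.
  by rewrite big1 ?mulr0 // => k _; rewrite /A adjmxC adjmx_vertices ?mul0r.
rewrite /corr (@moment_perm R d _ _ [:: (true, m); (false, m)]); last first.
  by apply/permP => Q /=; rewrite addnCA.
rewrite pmulr_lle0 ?invr_gt0 ?glued_total_gt0 //.
apply: le_trans (@moment_glued_unglued R d J m true m (false, m) J0 Jsym (fun c => Jii c m) _ _) _ => //.
by rewrite big1 // => k _; rewrite [J _ _ _]mxE /B adjmxC adjmx_vertices ?mulr0 ?mul0r.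
Qed.

Variables (l gam : R) (V : nat).
Hypotheses (Al : sqfro A <= l) (Bl : sqfro B <= l).
Hypotheses (Ag : forall i, \sum_j A i j <= gam) (Bg : forall i, \sum_j B i j <= gam).
Hypotheses (GV : (#|vertices G| <= V)%N) (G'V : (#|vertices G'| <= V)%N).
Hypotheses (tl : theta ^+ 2 * l <= 1 / 64) (tg : theta * gam <= 1 / 8).

Lemma corr_le :
  corr (false, m) <= b ^+ 2 * \sum_(k < d | (k < m)%N) A m k * B k m
    + b ^+ 3 * (\sum_(k < d | (k < m)%N) A m k * (B *m B) k m
                + \sum_(k < d | (k < m)%N) (A *m A) m k * B k m)
    + b ^+ 4 * (8 * Num.min (l ^+ 2) (V%:R * gam ^+ 2)).
Proof.
have b0 : 0 <= b by rewrite mulr_ge0.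
have A0 : mxle 0 A by move=> i j; rewrite mxE adjmx_ge0.
have B0 : mxle 0 B by move=> i j; rewrite mxE adjmx_ge0.
have := walk_expansion A0 B0 b0 v0 u0 correlation_walks correlation_walks'.
rewrite [v _ _]mxE => /le_trans; apply; rewrite lerD2l ler_wpM2l ?exprn_ge0 //.
rewrite minEle; case: ifP => _.
  apply: (walk_frobenius A0 B0 b0 v0 u0 correlation_walks correlation_walks' Al Bl).
  have -> : b ^+ 2 * l = 4 * (theta ^+ 2 * l) by rewrite /b; ring.
  by have := tl; lra.
apply: (@walk_degree _ _ _ _ _ _ _ _ A0 B0 b0 v0 u0 correlation_walks correlation_walks'
  gam V%:R (vertices G) (vertices G')) => //; rewrite ?ler_nat //.
- exact: adjmx_le1.
- exact: adjmx_le1.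
- by move=> i j; exact: adjmx_vertices.
- by move=> i j; exact: adjmx_vertices.
- by rewrite /b; have := tg; lra.
Qed.

End Step.

Section Total.
Variables (l gam : R) (V r : nat).
Hypotheses (Al : sqfro A <= l) (Bl : sqfro B <= l).
Hypotheses (Ag : forall i, \sum_j A i j <= gam) (Bg : forall i, \sum_j B i j <= gam).
Hypotheses (GV : (#|vertices G| <= V)%N) (G'V : (#|vertices G'| <= V)%N).
Hypotheses (tl : theta ^+ 2 * l <= 1 / 64) (tg : theta * gam <= 1 / 8).
Hypotheses (r0 : (0 < r)%N) (Gr : arboricity G = r) (G'r : arboricity G' = r).
Hypothesis tB : theta ^+ 2 * (512 * Num.min (l ^+ 2) (V%:R * gam ^+ 2)) <= r%:R.

Let b := 2 * theta.
Let beta (m : 'I_d) : R := b ^+ 2 * \sum_(k < d | (k < m)%N) A m k * B k m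
    + b ^+ 3 * (\sum_(k < d | (k < m)%N) A m k * (B *m B) k m
                + \sum_(k < d | (k < m)%N) (A *m A) m k * B k m)
    + b ^+ 4 * (8 * Num.min (l ^+ 2) (V%:R * gam ^+ 2)).

Lemma sum_beta_le : \sum_(m in S) beta m <= 5 * theta ^+ 2 * (r%:R * #|S|%:R).
Proof.
rewrite /beta !big_split /= -!mulr_sumr big_split /= sumr_const.
(* Walks of length 2 are common edges, which lie inside [S]. *)
have t2 : \sum_(m in S) \sum_(k < d | (k < m)%N) A m k * B k m <= r%:R * #|S|%:R.
  apply: (@le_trans _ _ (num_edges_in G S)%:R); last first.
    by rewrite -natrM ler_nat -Gr num_edges_in_le.
  apply: le_trans (sum_adj_le R G S); apply: ler_sum => m _.
  rewrite (bigID (mem S)) /= [X in _ + X]big1 ?addr0.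
    by apply: ler_sum => k _; rewrite ler_piMr ?adjmx_ge0 ?adjmx_le1.
  move=> k /andP[_]; rewrite inE negb_and => /orP[kG|kG'].
    by rewrite /A adjmx_vertices ?mul0r.
  by rewrite /B adjmxC adjmx_vertices ?mulr0.
have tB' : theta ^+ 2 * (512 * l ^+ 2) <= r%:R \/ theta ^+ 2 * (512 * (V%:R * gam ^+ 2)) <= r%:R.
  by move: tB; rewrite minEle; case: ifP => _; [left|right].
have := triangle_sum_le theta_ge0 r0 Gr Bl Bg GV tB'.
have := triangle_sum_le theta_ge0 r0 G'r Al Ag G'V tB'.
rewrite finset.setIC -/S.
have <- : \sum_(m in S) \sum_(k < d | (k < m)%N) (A *m A) m k * B k m =
          \sum_(m in S) \sum_(k < d | (k < m)%N) adjmx R G' m k * (adjmx R G *m adjmx R G) k m.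
  apply: eq_bigr => m _; apply: eq_bigr => k _; rewrite mulrC /B adjmxC; congr (_ * _).
  rewrite !mxE; apply: eq_bigr => j _; by rewrite mulrC /A ![adjmx R G _ j]adjmxC.
move: tB t2; set Q := Num.min _ _.
set x1 := \sum_(m in S) _; set x2 := \sum_(m in S) _; set x3 := \sum_(m in S) _.
set y := r%:R * #|S|%:R => tQ h1 h2 h3.
have t20 : 0 <= theta ^+ 2 by exact: sqr_ge0.
have q : theta ^+ 2 * (512 * Q) * #|S|%:R <= y by rewrite ler_wpM2r.
have e1 := ler_wpM2l t20 h1; have e2 := ler_wpM2l t20 h2.
have e3 := ler_wpM2l t20 h3; have e4 := ler_wpM2l t20 q.
rewrite -[Q *+ _]mulr_natr.
(* The constant 5 is [4 + 2 * 8 * (3 / 64) + 1 / 4], from walks of length 2, of length 3, and longer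
   ones. *)
have -> : b ^+ 2 * x1 + b ^+ 3 * (x3 + x2) + b ^+ 4 * (8 * (Q * #|S|%:R)) =
  4 * (theta ^+ 2 * x1) + 8 * (theta ^+ 2 * (theta * x2)) + 8 * (theta ^+ 2 * (theta * x3))
  + 1 / 4 * (theta ^+ 2 * (theta ^+ 2 * (512 * Q) * #|S|%:R)).
  by rewrite /b; field.
move: e1 e2 e3 e4; rewrite !mulrA; lra.
Qed.

Lemma glued_totalS (m : 'I_d) :
  Z m.+1 = Z m * (1 + moment (glued J m) [:: (false, m); (true, m)] / Z m).
Proof.
rewrite mulrDr mulr1 mulrCA divff ?mulr1 ?gt_eqF ?glued_total_gt0 //.
rewrite -[Z m]mul1r -[X in _ + X]mul1r -moment_linear; apply: eq_moment => w.
rewrite /glued mulrAC; congr (_ * _); rewrite /gluing (bigD1 m) //= mulrC mul1r.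
by congr (_ * _); apply: eq_bigl => i; rewrite ltnS andbC ltn_neqAle.
Qed.

(** Gluing [m] multiplies the mass by one plus a correlation, at most the exponential of [beta m];
    outside [S] the correlation is nonpositive and the mass does not grow. *)
Lemma glued_total_le k : (k <= d)%N ->
  Z k <= Z 0 * expR (\sum_(m in S | (m < k)%N) beta m).
Proof.
elim: k => [|k IH] kd.
  by rewrite big_pred0 ?expR0 ?mulr1 // => m; rewrite ltn0 andbF.
pose m := Ordinal kd; rewrite (glued_totalS m) /=.
have Zk := glued_total_gt0 k.
have step : 1 + moment (glued J m) [:: (false, m); (true, m)] / Z m <=
    expR (if m \in S then beta m else 0).
  apply: le_trans (expR_ge1Dx _); rewrite lerD2l; case: ifP => mS.
    exact: (@corr_le m l gam V Al Bl Ag Bg GV G'V tl tg).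
  by apply: corr_notin; rewrite mS.
apply: le_trans (ler_wpM2l (ltW Zk) step) _.
apply: le_trans (ler_wpM2r (expR_ge0 _) (IH (ltnW kd))) _.
rewrite -mulrA -expRD ler_wpM2l ?(ltW (glued_total_gt0 _)) // ler_expR.
rewrite !big_mkcondl /= [X in _ <= X](bigD1 m) //= [X in X <= _]addrC lerD2l.
rewrite le_eqVlt; apply/orP; left; apply/eqP; apply: eq_bigl => i.
by rewrite ltnS andbC -val_eqE -ltn_neqAle.
Qed.

Lemma energyE (w : config d * config d) :
  expR (energy J w) = ising_weight (theta *: A) w.1 * ising_weight (theta *: B) w.2.
Proof.
rewrite /energy big_bool /= addrC expRD /ising_weight; congr (expR _ * expR _);
  by apply: eq_bigr => i _; apply: eq_bigr => j _; rewrite mulrA.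
Qed.

Lemma glued_total0 : Z 0 = partition_function (theta *: A) * partition_function (theta *: B).
Proof.
rewrite /partition_function big_distrlr /= pair_bigA /=; apply: eq_bigr => w _.
by rewrite big_nil mulr1 /glued energyE /gluing big_pred0 ?mul1r.
Qed.

Lemma glued_totald : Z d =
  2 ^+ d * \sum_x ising_weight (theta *: A) x * ising_weight (theta *: B) x.
Proof.
transitivity (\sum_x \sum_y glued J d (x, y)).
  by rewrite pair_bigA; apply: eq_bigr => -[x y] _; rewrite big_nil mulr1.
rewrite mulr_sumr; apply: eq_bigr => x _; rewrite (bigD1 x) //= big1 ?addr0.
  rewrite /glued energyE; congr (_ * _); rewrite /gluing.
  rewrite -[in RHS](card_ord d) -prodr_const; apply: eq_big => i; first by rewrite ltn_ord.
  by move=> _; rewrite /spin2 /spin /=; case: (x i); ring.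
move=> y yx; have [i xyi] : exists i, x i != y i.
  by apply/existsP; apply: contraR yx => /existsPn h; apply/eqP/ffunP => i; apply/esym/eqP/negPn/h.
rewrite /glued /gluing (bigD1 i) ?ltn_ord //= (_ : 1 + _ = 0) ?mul0r //.
by move: xyi; rewrite /spin2 /spin /=; case: (x i); case: (y i) => // _; ring.
Qed.

Lemma overlap_ratio_le :
  2 ^+ d * \sum_x ising (theta *: A) x * ising (theta *: B) x
  <= expR (5 * theta ^+ 2 * (r%:R * #|S|%:R)).
Proof.
have Zpos : 0 < partition_function (theta *: A) * partition_function (theta *: B).
  by rewrite -glued_total0 glued_total_gt0.
rewrite -(ler_pM2l Zpos) -glued_total0.
have -> : Z 0 * (2 ^+ d * \sum_x ising (theta *: A) x * ising (theta *: B) x) = Z d.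
  rewrite glued_totald mulrCA; congr (_ * _); rewrite mulr_sumr; apply: eq_bigr => x _.
  rewrite /ising mulrACA -invfM -glued_total0 mulrCA divff ?mulr1 //.
  by rewrite gt_eqF // glued_total_gt0.
apply: le_trans (glued_total_le (leqnn d)) _.
rewrite ler_wpM2l ?(ltW (glued_total_gt0 _)) // ler_expR.
apply: le_trans sum_beta_le; rewrite le_eqVlt; apply/orP; left; apply/eqP.
by apply: eq_bigl => i; rewrite ltn_ord andbT.
Qed.

End Total.


End ChiSquare.

(** * Exponential moments under negative association *)

Section UniformMean.
Set Implicit Arguments.
Unset Strict Implicit.
Variables (R : realType) (T : finType) (C : {set T}).
Hypothesis C0 : (0 < #|C|)%N.
Implicit Types X Y : T -> R.

Let Cr : #|C|%:R != 0 :> R.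
Proof. by rewrite pnatr_eq0 -lt0n. Qed.

Lemma unif_mean_le X Y : (forall t, t \in C -> X t <= Y t) ->
  unif_mean C X <= unif_mean C Y.
Proof. by move=> XY; rewrite ler_wpM2r ?invr_ge0 ?ler0n //; apply: ler_sum. Qed.

Lemma eq_unif_mean X Y : (forall t, t \in C -> X t = Y t) ->
  unif_mean C X = unif_mean C Y.
Proof. by move=> XY; rewrite /unif_mean; congr (_ / _); apply: eq_bigr. Qed.

Lemma unif_mean_cst (a : R) : unif_mean C (fun=> a) = a.
Proof. by rewrite /unif_mean sumr_const -[_ *+ #|_|]mulr_natr mulfK. Qed.

Lemma unif_meanD X Y : unif_mean C (fun t => X t + Y t) = unif_mean C X + unif_mean C Y.
Proof. by rewrite /unif_mean big_split mulrDl. Qed.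

Lemma unif_meanZ a X : unif_mean C (fun t => a * X t) = a * unif_mean C X.
Proof. by rewrite /unif_mean -mulr_sumr mulrA. Qed.

Lemma unif_mean_sum (I : Type) (s : seq I) (P : pred I) (F : I -> T -> R) :
  unif_mean C (fun t => \sum_(i <- s | P i) F i t) = \sum_(i <- s | P i) unif_mean C (F i).
Proof. by rewrite /unif_mean exchange_big /= mulr_suml. Qed.

Lemma unif_covE X Y : unif_cov C X Y =
  unif_mean C (fun t => X t * Y t) - unif_mean C X * unif_mean C Y.
Proof.
rewrite /unif_cov; set x := unif_mean C X; set y := unif_mean C Y.
transitivity (unif_mean C (fun t => X t * Y t + ((- y) * X t + ((- x) * Y t + x * y)))).
  by apply: eq_unif_mean => t _; ring.
rewrite !unif_meanD unif_mean_cst !unif_meanZ /x /y; ring.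
Qed.

(** Negative association is used for one variable against the sum of the others: both exponentials
    are non-decreasing, so the mean of their product is at most the product of their means. *)
Lemma neg_associated_expR (I : finType) (A : {set I}) (Y : I -> T -> R) (mu : R) (s : seq I) :
  neg_associated C A Y -> 0 <= mu -> uniq s -> {subset s <= A} ->
  unif_mean C (fun t => expR (mu * \sum_(i <- s) Y i t)) <=
  \prod_(i <- s) unif_mean C (fun t => expR (mu * Y i t)).
Proof.
move=> NA mu0; elim: s => [|i s IH] us sA.
  rewrite big_nil (eq_unif_mean (Y := fun=> 1)) ?unif_mean_cst // => t _.
  by rewrite big_nil mulr0 expR0.
move: (us) => /= /andP[_ us'].
have sA' : {subset s <= A} by move=> j js; apply: sA; rewrite inE js orbT.
have m0 j : 0 <= unif_mean C (fun t => expR (mu * Y j t)).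
  by rewrite divr_ge0 // sumr_ge0 // => t _; exact: expR_ge0.
pose f (x : 1.-tuple R) := expR (mu * tnth x ord0).
pose g (x : (size s).-tuple R) := expR (mu * \sum_a tnth x a).
have := NA 1%N (size s) [tuple i] (in_tuple s) f g.
rewrite unif_covE subr_le0 => H.
have {H} : unif_mean C (fun t => expR (mu * Y i t) * expR (mu * \sum_(i <- s) Y i t)) <=
   unif_mean C (fun t => expR (mu * Y i t)) * unif_mean C (fun t => expR (mu * \sum_(i <- s) Y i t)).
  have E1 : (fun t => f [tuple Y (tnth [tuple i] a) t | a < 1]) = (fun t => expR (mu * Y i t)).
    by apply/funext => t; rewrite /f tnth_mktuple.
  have E2 : (fun t => g [tuple Y (tnth (in_tuple s) a) t | a < size s]) =
      (fun t => expR (mu * \sum_(i <- s) Y i t)).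
    apply/funext => t; rewrite /g [in RHS]big_tnth; congr (expR (_ * _)).
    by apply: eq_bigr => a _; rewrite tnth_mktuple.
  rewrite -E1 -E2 (_ : (fun t => _ * _) = (fun t => f [tuple Y (tnth [tuple i] a) t | a < 1] *
    g [tuple Y (tnth (in_tuple s) a) t | a < size s])); last first.
    by apply/funext => t; rewrite [in RHS](congr1 (@^~ t) E1) [in RHS](congr1 (@^~ t) E2).
  apply: H => //.
  - rewrite add1n -[(size s).+1]/(size (i :: s)) -(card_uniqP us).
    by apply: subset_leq_card; apply/fintype.subsetP.
  - by move=> x y xy; rewrite ler_expR ler_wpM2l.
  - by move=> x y xy; rewrite ler_expR ler_wpM2l //; apply: ler_sum.
move=> H; under eq_unif_mean do rewrite big_cons mulrDr expRD.
rewrite big_cons; apply: le_trans H _; rewrite ler_wpM2l //; exact: IH.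
Qed.

End UniformMean.

(** For an indicator, [expR (mu * Y) = 1 + (expR mu - 1) * Y], and [1 + x <= expR x] merges the
    factors into one exponential. *)
Lemma overlap_exp_moment (R : realType) (d : nat) (C : {set sgraph d}) (G : sgraph d) (mu : R) :
  (0 < #|C|)%N -> incoherent R C -> 0 <= mu ->
  unif_mean C (fun G' => expR (mu * #|(vertices G :&: vertices G')%SET|%:R)) <=
  expR ((expR mu - 1) * unif_mean C (fun G' => #|(vertices G :&: vertices G')%SET|%:R)).
Proof.
move=> C0 inc mu0.
have card G' : #|(vertices G :&: vertices G')%SET|%:R =
    \sum_(i <- enum (vertices G)) (i \in vertices G')%:R :> R.
  rewrite big_enum /= -sum1_card natr_sum [RHS]big_mkcond [LHS]big_mkcond /=.
  by apply: eq_bigr => i _; rewrite inE; case: (i \in vertices G); case: (i \in vertices G').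
under eq_unif_mean do rewrite card.
under [X in _ <= expR (_ * X)]eq_unif_mean do rewrite card.
have sub : {subset enum (vertices G) <= vertices G} by move=> i; rewrite mem_enum.
apply: le_trans (neg_associated_expR C0 (inc G) mu0 (enum_uniq _) sub) _.
rewrite unif_mean_sum mulr_sumr expR_sum; apply: ler_prod => i _.
apply/andP; split; first by rewrite divr_ge0 // sumr_ge0 // => t _; exact: expR_ge0.
apply: le_trans (expR_ge1Dx _).
rewrite -unif_meanZ -[X in _ <= X + _](unif_mean_cst C0) -unif_meanD.
rewrite le_eqVlt; apply/orP; left; apply/eqP; apply: eq_unif_mean => G' _.
by case: (_ \in _); rewrite ?mulr1 ?mulr0 ?expR0 ?addr0 //; ring.
Qed.

(** * Le Cam's method for a finite mixture of alternatives *)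

Section LeCam.
Set Implicit Arguments.
Unset Strict Implicit.
Variables (R : realType) (d n : nat).
Implicit Types (Theta : 'M[R]_d).

Lemma sum_tuple_prod (T : finType) (F : T -> R) :
  \sum_(x : n.-tuple T) \prod_(k < n) F (tnth x k) = (\sum_y F y) ^+ n.
Proof.
rewrite -[in RHS](card_ord n) -prodr_const bigA_distr_bigA /=.
rewrite (reindex (fun f : {ffun 'I_n -> T} => [tuple f i | i < n])) /=.
  by apply: eq_bigr => f _; apply: eq_bigr => k _; rewrite tnth_mktuple.
apply: onW_bij; exists (fun x : n.-tuple T => [ffun i => tnth x i]).
  by move=> f; apply/ffunP => i; rewrite ffunE tnth_mktuple.
by move=> x; apply: eq_from_tnth => i; rewrite tnth_mktuple ffunE.
Qed.

Lemma partition_function_gt0 Theta : 0 < partition_function Theta.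
Proof.
rewrite /partition_function (bigD1 [ffun=> true]) //= ltr_pwDl ?expR_gt0 //.
by apply: sumr_ge0 => x _; exact: expR_ge0.
Qed.

Lemma ising_ge0 Theta x : 0 <= ising Theta x.
Proof. by rewrite divr_ge0 ?expR_ge0 // ltW // partition_function_gt0. Qed.

Lemma sum_ising Theta : \sum_x ising Theta x = 1.
Proof. by rewrite -mulr_suml divff // gt_eqF // partition_function_gt0. Qed.

Lemma ising0 (x : config d) : ising (0 : 'M[R]_d) x = (2 ^+ d)^-1.
Proof.
have w1 y : ising_weight (0 : 'M[R]_d) y = 1.
  rewrite /ising_weight big1 ?expR0 // => i _; rewrite big1 // => j _.
  by rewrite mxE !mul0r.
rewrite /ising w1 mul1r /partition_function; congr (_^-1).
under eq_bigr do rewrite w1.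
by rewrite sumr_const card_ffun card_bool card_ord natrX.
Qed.

Definition sample_prob Theta (x : n.-tuple (config d)) : R :=
  \prod_(k < n) ising Theta (tnth x k).

Lemma sample_prob_ge0 Theta x : 0 <= sample_prob Theta x.
Proof. by apply: prodr_ge0 => k _; exact: ising_ge0. Qed.

Lemma sum_sample_prob Theta : \sum_x sample_prob Theta x = 1.
Proof. by rewrite sum_tuple_prod sum_ising expr1n. Qed.

Lemma ising_prob_predC Theta (E : pred (n.-tuple (config d))) :
  ising_prob Theta (fun x => ~~ E x) = 1 - ising_prob Theta E.
Proof.
by rewrite -(sum_sample_prob Theta) [X in _ = X - _](bigID E) /= addrAC subrr add0r.
Qed.

Lemma ising_prob_ge0 Theta E : 0 <= ising_prob (n := n) Theta E.
Proof. by apply: sumr_ge0 => x _; exact: sample_prob_ge0. Qed.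

Lemma ising_prob_le1 Theta E : ising_prob (n := n) Theta E <= 1.
Proof. by rewrite -subr_ge0 -ising_prob_predC ising_prob_ge0. Qed.

Section Mixture.
Variables (T : finType) (C : {set T}) (Theta : T -> 'M[R]_d).
Hypothesis C0 : (0 < #|C|)%N.
Let S : set 'M[R]_d := [set Theta t | t in [set` C]]%classic.

Let risks_bounded (psi : n.-tuple (config d) -> bool) :
  has_ubound [set ising_prob Th (fun x => ~~ psi x) | Th in S]%classic.
Proof. by exists 1 => _ [Th _ <-]; exact: ising_prob_le1. Qed.

(** The worst type II error is at least its average, so the mixture [q] can replace the class; its
    distance to the null law is controlled by the chi-square divergence, [eps] being a free
    parameter. *)
Lemma test_risk_ge (psi : n.-tuple (config d) -> bool) (eps : R) : 0 < eps ->
  1 - eps - (unif_mean C (fun t => unif_mean C (fun t' =>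
     (2 ^+ d * \sum_x ising (Theta t) x * ising (Theta t') x) ^+ n)) - 1) / (4 * eps)
  <= test_risk S psi.
Proof.
move=> eps0; pose p : R := (2 ^+ d)^-1 ^+ n.
pose q x := unif_mean C (fun t => sample_prob (Theta t) x).
have p0 : 0 < p by rewrite exprn_gt0 // invr_gt0 exprn_gt0.
have pE x : sample_prob 0 x = p.
  by rewrite /sample_prob (eq_bigr (fun=> (2 ^+ d)^-1)) ?prodr_const ?card_ord // => k _; rewrite ising0.
have sp : \sum_(x : n.-tuple (config d)) p = 1.
  by rewrite -(sum_sample_prob 0); apply: eq_bigr => x _; rewrite pE.
have sq : \sum_x q x = 1.
  rewrite -unif_mean_sum (eq_unif_mean (Y := fun=> 1)) ?unif_mean_cst // => t _.
  exact: sum_sample_prob.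
have sup_ge : 1 - \sum_(x | psi x) q x <=
    sup [set ising_prob Th (fun x => ~~ psi x) | Th in S]%classic.
  rewrite -unif_mean_sum -{1}(unif_mean_cst C0 1) -mulN1r -unif_meanZ -unif_meanD.
  rewrite -[X in _ <= X](unif_mean_cst C0); apply: unif_mean_le => t tC.
  rewrite mulN1r -ising_prob_predC; apply: ub_le_sup; first exact: risks_bounded.
  by exists (Theta t) => //; exists t.
(* Independence of the samples turns the second moment of the mixture into [n]-th powers of
   single-sample overlaps. *)
have chi : \sum_x q x ^+ 2 / p = unif_mean C (fun t => unif_mean C (fun t' =>
     (2 ^+ d * \sum_x ising (Theta t) x * ising (Theta t') x) ^+ n)).
  transitivity (\sum_x unif_mean C (fun t => unif_mean C (fun t' =>
      p^-1 * (sample_prob (Theta t) x * sample_prob (Theta t') x)))).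
    apply: eq_bigr => x _; rewrite (eq_unif_mean (Y := fun t => (p^-1 * q x) * sample_prob (Theta t) x)).
      by rewrite unif_meanZ -/(q x) expr2; ring.
    by move=> t _; rewrite !unif_meanZ -/(q x); ring.
  rewrite -unif_mean_sum; apply: eq_unif_mean => t _.
  rewrite -unif_mean_sum; apply: eq_unif_mean => t' _.
  rewrite -mulr_sumr exprMn -sum_tuple_prod /p exprVn invrK; congr (_ * _).
  by apply: eq_bigr => x _; rewrite big_split.
rewrite -chi /test_risk.
have -> : ising_prob 0 psi = \sum_(x | psi x) p by apply: eq_bigr => x _; exact: pE.
(* AM-GM: the difference of the two sides is a square. *)
have bound x : q x - p <= eps * p + (q x - p) ^+ 2 / p / (4 * eps).
  rewrite -subr_ge0 (_ : _ - _ = (q x - p - 2 * eps * p) ^+ 2 / (4 * eps * p)).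
    by apply: divr_ge0; [exact: sqr_ge0 | rewrite !mulr_ge0 // ltW].
  by field; rewrite !gt_eqF.
have bound0 x : 0 <= eps * p + (q x - p) ^+ 2 / p / (4 * eps).
  apply: addr_ge0; first by rewrite mulr_ge0 // ltW.
  apply: divr_ge0; last by rewrite mulr_ge0 // ltW.
  by apply: divr_ge0; [exact: sqr_ge0 | exact: ltW].
have main : \sum_(x | psi x) (q x - p) <= eps + (\sum_x q x ^+ 2 / p - 1) / (4 * eps).
  (* The bounds being nonnegative, the sum over the rejection region extends to the whole sample
     space. *)
  apply: (@le_trans _ _ (\sum_x (eps * p + (q x - p) ^+ 2 / p / (4 * eps)))).
    rewrite big_mkcond /=; apply: ler_sum => x _; case: ifP => _; [exact: bound | exact: bound0].
  rewrite big_split /= -mulr_sumr sp mulr1 -mulr_suml lerD2l le_eqVlt; apply/orP; left.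
  apply/eqP; congr (_ / _).
  transitivity (\sum_x (q x ^+ 2 / p + ((-2) * q x + p))).
    by apply: eq_bigr => x _; field; rewrite gt_eqF.
  by rewrite !big_split /= -mulr_sumr sp sq; ring.
move: main sup_ge; rewrite sumrB.
set a := \sum_(x | psi x) q x; set c := \sum_(x | psi x) p; set e := (_ - 1) / _; set f := sup _.
lra.
Qed.

(** The witness is the test that never rejects. *)
Lemma minimax_risk_le1 : minimax_risk n S <= 1.
Proof.
apply: le_trans (ge_inf _ (imageP _ (I : setT (fun=> false)))) _.
  exists 0 => _ [psi _ <-]; rewrite addr_ge0 ?ising_prob_ge0 //.
  have [t tC] : exists t, t \in C by apply/set0Pn; rewrite -card_gt0.
  apply: le_trans (ising_prob_ge0 (Theta t) _) _; apply: ub_le_sup; first exact: risks_bounded.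
  by exists (Theta t) => //; exists t.
rewrite /test_risk /ising_prob big_pred0 // add0r; apply: ge_sup.
  have [t tC] : exists t, t \in C by apply/set0Pn; rewrite -card_gt0.
  by eexists; exists (Theta t); [exists t|].
by move=> _ [Th _ <-]; exact: ising_prob_le1.
Qed.

Lemma minimax_risk_ge (eps : R) : 0 < eps ->
  1 - eps - (unif_mean C (fun t => unif_mean C (fun t' =>
     (2 ^+ d * \sum_x ising (Theta t) x * ising (Theta t') x) ^+ n)) - 1) / (4 * eps)
  <= minimax_risk n S.
Proof.
move=> eps0; apply: lb_le_inf.
  by eexists; exists (fun=> false).
by move=> _ [psi _ <-]; exact: test_risk_ge.
Qed.

End Mixture.
End LeCam.

(** * Risk bound for a fixed sample size *)

Section SingleProblem.
Set Implicit Arguments.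
Unset Strict Implicit.
Variables (R : realType) (d n r : nat) (C : {set sgraph d}) (theta : R).
Let N := mean_overlap R C.
Let L := ln N^-1.
Hypotheses (n0 : (0 < n)%N) (C0 : (0 < #|C|)%N).
Hypothesis Cr : forall G, G \in C -> arboricity G = r.
Hypothesis inc : incoherent R C.
Hypothesis theta0 : 0 < theta.
Hypothesis theta_le : theta <=
  Order.min (Num.sqrt (L / (6 * n%:R * r%:R)))
    (Order.min (Num.sqrt (r%:R / calB R C)) (1 / (8 * Order.max (Lambda R C) (Gamma R C)))).

Let fro_Lambda G : G \in C -> sqfro (adjmx R G) <= Lambda R C ^+ 2.
Proof.
move=> GC; have -> : sqfro (adjmx R G) = frobenius_norm (adjmx R G) ^+ 2.
  by rewrite sqr_sqrtr ?sqfro_ge0.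
have le : frobenius_norm (adjmx R G) <= Lambda R C by exact: le_bigmax_cond.
by rewrite ler_sqr ?nnegrE // ?(le_trans _ le) // sqrtr_ge0.
Qed.

Let row_Gamma G i : G \in C -> \sum_j adjmx R G i j <= Gamma R C.
Proof.
move=> GC; have : opnorm1 (adjmx R G) <= Gamma R C by exact: le_bigmax_cond.
apply: le_trans; have := le_bigmax 0 (fun j => \sum_i `|adjmx R G i j|) i.
apply: le_trans; rewrite le_eqVlt; apply/orP; left; apply/eqP.
by apply: eq_bigr => j _; rewrite adjmxC ger0_norm // adjmx_ge0.
Qed.

Let Lambda0 : 0 <= Lambda R C. Proof. exact: bigmax_ge_id. Qed.
Let Gamma0 : 0 <= Gamma R C. Proof. exact: bigmax_ge_id. Qed.
Let N0 : 0 <= N. Proof. exact: bigmax_ge_id. Qed.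

(** As [theta] is positive, so is the radicand; with [r = 0] it would be 0 by the convention on
    division. *)
Let r_gt0_L : (0 < r)%N /\ n%:R * (theta ^+ 2 * r%:R) <= L / 6.
Proof.
move: theta_le; rewrite le_min => /andP[h _].
have := lt_le_trans theta0 h; rewrite sqrtr_gt0 => q0.
have th2 : theta ^+ 2 <= L / (6 * n%:R * r%:R).
  by rewrite -(sqr_sqrtr (ltW q0)) ler_sqr ?nnegrE ?sqrtr_ge0 // ltW.
have [r0|r0] := posnP r; first by move: q0; rewrite r0 mulr0 invr0 mulr0 ltxx.
split=> //; have nr : 0 < 6 * n%:R * r%:R :> R by rewrite !mulr_gt0 ?ltr0n.
move: th2; rewrite ler_pdivlMr // => th2; rewrite ler_pdivlMr //; lra.
Qed.

(** If [N] were 0, the default values of inverse and logarithm would give [L = 0]. *)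
Lemma overlap_gt0 : 0 < N.
Proof.
have [r0 Lr] := r_gt0_L.
have L0 : 0 < L.
  have : 0 < n%:R * (theta ^+ 2 * r%:R) by rewrite !mulr_gt0 ?ltr0n ?exprn_gt0.
  move=> /lt_le_trans/(_ Lr); lra.
rewrite lt_neqAle N0 andbT; apply/eqP => N00.
by move: L0; rewrite /L -N00 invr0 ln0 // ltxx.
Qed.

Let ratio_le G G' : G \in C -> G' \in C ->
  2 ^+ d * \sum_x ising (theta *: adjmx R G) x * ising (theta *: adjmx R G') x <=
  expR (5 * theta ^+ 2 * (r%:R * #|(vertices G :&: vertices G')%SET|%:R)).
Proof.
move=> GC G'C; move: theta_le; rewrite !le_min => /and3P[_ hB hL].
have th0 := ltW theta0.
have mx0 : 0 < Order.max (Lambda R C) (Gamma R C).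
  have := lt_le_trans theta0 hL; rewrite mul1r invr_gt0 pmulr_rgt0 //.
have tmx : theta * Order.max (Lambda R C) (Gamma R C) <= 1 / 8.
  move: hL; rewrite ler_pdivlMr ?mulr_gt0 //; lra.
have tL : theta * Lambda R C <= 1 / 8.
  by apply: le_trans tmx; rewrite ler_wpM2l // le_max lexx.
have tG : theta * Gamma R C <= 1 / 8.
  by apply: le_trans tmx; rewrite ler_wpM2l // le_max lexx orbT.
have V G1 : G1 \in C -> (#|vertices G1| <= Vmax C)%N by move=> ?; exact: leq_bigmax_cond.
apply: (@overlap_ratio_le R d G G' theta th0 (Lambda R C ^+ 2) (Gamma R C) (Vmax C) r);
  rewrite ?fro_Lambda ?Cr ?V //; try by move=> i; exact: row_Gamma.
- rewrite -exprMn (_ : 1 / 64 = (1 / 8) ^+ 2 :> R); last by field.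
  by rewrite ler_sqr ?nnegrE // ?mulr_ge0.
- by have [] := r_gt0_L.
have := lt_le_trans theta0 hB; rewrite sqrtr_gt0 => q0.
have B0 : 0 < calB R C.
  have [r0 _] := r_gt0_L.
  by move: q0; rewrite pmulr_rgt0 ?ltr0n // invr_gt0.
have : theta ^+ 2 * calB R C <= r%:R.
  rewrite -ler_pdivlMr // -(sqr_sqrtr (ltW q0)) ler_sqr ?nnegrE ?sqrtr_ge0 //.
apply: le_trans; apply: ler_wpM2l; first exact: sqr_ge0.
apply: ler_wpM2l; first exact: ler0n.
rewrite -exprM.
(* Passing from the maximum to [Gamma] only lowers the second branch. *)
rewrite le_min ge_min lexx /= ge_min; apply/orP; right.
rewrite ler_wpM2l // ler_sqr ?nnegrE //; last by rewrite le_max Gamma0.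
by rewrite le_max lexx.
Qed.

(** The 5 of [ratio_le] and the 6 of the threshold give [mu = 5 * (L / 6)]; as [N = expR (- L)], the
    product [expR mu * N] is [expR (- (L / 6))]. *)
Lemma chi_square_le :
  unif_mean C (fun G => unif_mean C (fun G' =>
    (2 ^+ d * \sum_x ising (theta *: adjmx R G) x * ising (theta *: adjmx R G') x) ^+ n))
  <= expR (expR (- (L / 6))).
Proof.
have [r0 Lr] := r_gt0_L.
rewrite -[X in _ <= X](unif_mean_cst C0); apply: unif_mean_le => G GC.
pose mu := 5 * (L / 6).
have mu0 : 0 <= mu.
  apply: mulr_ge0 => //; apply: le_trans Lr.
  by apply: mulr_ge0 => //; apply: mulr_ge0 => //; exact: sqr_ge0.
apply: (@le_trans _ _ (unif_mean C (fun G' => expR (mu * #|(vertices G :&: vertices G')%SET|%:R)))).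
  apply: unif_mean_le => G' G'C.
  apply: (@le_trans _ _ (expR (5 * theta ^+ 2 * (r%:R * #|(vertices G :&: vertices G')%SET|%:R)) ^+ n)).
    rewrite lerXn2r ?nnegrE ?expR_ge0 ?ratio_le // mulr_ge0 ?exprn_ge0 //.
    by apply: sumr_ge0 => x _; rewrite mulr_ge0 ?ising_ge0.
  rewrite -expRM_natl ler_expR /mu.
  rewrite (_ : n%:R * _ = 5 * (n%:R * (theta ^+ 2 * r%:R)) * #|(vertices G :&: vertices G')%SET|%:R); last by ring.
  by rewrite ler_wpM2r // ler_pM2l.
apply: le_trans (@overlap_exp_moment R d C G mu C0 inc mu0) _; rewrite ler_expR.
have NL : N = expR (- L) by rewrite /L lnV ?posrE ?overlap_gt0 // opprK lnK // posrE overlap_gt0.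
have le : unif_mean C (fun G' => #|(vertices G :&: vertices G')%SET|%:R) <= N.
  exact: (le_bigmax_cond _ (fun G => unif_mean C (fun G' => #|(vertices G :&: vertices G')%SET|%:R))).
apply: (@le_trans _ _ (expR mu * N)); last first.
  by rewrite NL -expRD /mu ler_expR; lra.
apply: (@le_trans _ _ ((expR mu - 1) * N)).
  by rewrite ler_wpM2l // subr_ge0 -expR0 ler_expR.
by rewrite ler_wpM2r //; lra.
Qed.

(** The sixth power answers to [L / 6]: the sixth root of [N] is at most [eps ^+ 2], so the
    chi-square term is at most [2 * eps ^+ 2], and at most [eps] after division by [4 * eps]. *)
Lemma minimax_risk_ge_eps (eps : R) : 0 < eps -> eps <= 1 / 2 -> N <= (eps ^+ 2) ^+ 6 ->
  1 - 2 * eps <= minimax_risk n [set theta *: adjmx R G | G in [set` C]].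
Proof.
move=> e0 e1 Ne.
have NL : N = expR (- L) by rewrite /L lnV ?posrE ?overlap_gt0 // opprK lnK // posrE overlap_gt0.
have x1 : expR (- (L / 6)) <= eps ^+ 2.
  rewrite -(@ler_pXn2r _ 6) ?nnegrE ?expR_ge0 ?sqr_ge0 //.
  by rewrite -expRM_natl (_ : 6%:R * _ = - L) -?NL //; field.
have x2 : expR (eps ^+ 2) <= 1 + 2 * eps ^+ 2.
  have s0 : 0 <= eps ^+ 2 by exact: sqr_ge0.
  have s1 : eps ^+ 2 <= 1 / 4 by rewrite expr2; nra.
  (* With [s = eps ^+ 2], the bound is [expR s <= 1 / (1 - s) <= 1 + 2 * s], valid as
     [s <= 1 / 4]. *)
  have := expR_ge1Dx (- eps ^+ 2); rewrite expRN => h.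
  have : expR (eps ^+ 2) * (1 - eps ^+ 2) <= 1.
    by rewrite mulrC -ler_pdivlMr ?expR_gt0 // mul1r.
  have := expR_gt0 (eps ^+ 2); nra.
have x3 := chi_square_le.
apply: le_trans (minimax_risk_ge n (fun G => theta *: adjmx R G) C0 e0).
set X := unif_mean _ _ in x3 *.
have X1 : X - 1 <= 2 * eps ^+ 2.
  rewrite lerBlDl; apply: le_trans x3 _; apply: le_trans x2.
  by rewrite ler_expR.
have X2 : (X - 1) / (4 * eps) <= eps.
  rewrite ler_pdivrMr ?mulr_gt0 //; apply: le_trans X1 _.
  by have := sqr_ge0 eps; lra.
by move: X2; set Y := (X - 1) / _; lra.
Qed.

End SingleProblem.

(** * Passage to the limit in the sample size *)

Theorem theorem2p2 (R : realType) (d : nat -> nat)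
    (G1 Gs : forall n, {set sgraph (d n)}) (theta : nat -> R)
    (G1_nonempty : forall n, (0 < n)%N -> (0 < #|G1 n|)%N)
    (G1_no_empty_graph : forall n, (0 < n)%N ->
       forall G, G \in G1 n -> edges G != finset.set0)
    (Gs_nonempty : forall n, (0 < n)%N -> (0 < #|Gs n|)%N)
    (Gs_sub_G1 : forall n, (0 < n)%N -> Gs n \subset G1 n)
    (Gs_arboricity : forall n, (0 < n)%N ->
       forall G, G \in Gs n -> arboricity G = min_arboricity (G1 n))
    (theta_gt0 : forall n, (0 < n)%N -> 0 < theta n)
    (Gs_incoherent : forall n, (0 < n)%N -> incoherent R (Gs n))
    (overlap_cvg0 : mean_overlap R (Gs n) @[n --> \oo] --> (0 : R))
    (theta_le : \forall n \near \oo,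
       theta n <=
         Order.min
           (Num.sqrt (ln (mean_overlap R (Gs n))^-1
                      / (6 * n%:R * (min_arboricity (G1 n))%:R)))
           (Order.min
              (Num.sqrt ((min_arboricity (G1 n))%:R / calB R (Gs n)))
              (1 / (8 * Order.max (Lambda R (Gs n)) (Gamma R (Gs n)))))) :
  limn_einf (fun n => (@minimax_risk R (d n) n
    [set theta n *: adjmx R G | G in [set` Gs n]])%:E) = 1%:E.
Proof.
pose u n : R := @minimax_risk R (d n) n [set theta n *: adjmx R G | G in [set` Gs n]].
rewrite -[LHS]/(limn_einf (fun n => (u n)%:E)).
(* The risk is at most 1 throughout, so a lower bound tending to 1 yields a genuine limit. *)
suff cvg_u : u n @[n --> \oo] --> (1 : R).
  have cvg_e : (fun n => (u n)%:E) @ \oo --> 1%:E by apply: cvg_EFin => //; exact: nearW.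
  by rewrite is_cvg_limn_einfE; [exact: cvg_lim | apply/cvg_ex; exists 1%:E].
apply/cvgrPdist_le => e e0.
(* The first term ensures [2 * eps <= e], the second the condition [eps <= 1 / 2]. *)
pose eps := Order.min (e / 2) (1 / 2).
have eps0 : 0 < eps by rewrite lt_min !divr_gt0.
have N_small : \forall n \near \oo, mean_overlap R (Gs n) <= (eps ^+ 2) ^+ 6.
  have d0 : 0 < (eps ^+ 2) ^+ 6 by rewrite !exprn_gt0.
  move/cvgrPdist_le : overlap_cvg0 => /(_ _ d0); apply: filterS => n.
  by rewrite sub0r normrN; apply: le_trans; exact: ler_norm.
near=> n.
have n0 : (0 < n)%N by near: n; exact: nbhs_infty_gt.
have le1 : u n <= 1 := minimax_risk_le1 n (fun G => theta n *: adjmx R G) (Gs_nonempty n n0).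
rewrite ger0_norm ?subr_ge0 // lerBlDl -lerBlDr.
have ge : 1 - 2 * eps <= u n.
  apply: (minimax_risk_ge_eps n0 (Gs_nonempty n n0) (Gs_arboricity n n0)
    (Gs_incoherent n n0) (theta_gt0 n n0)) => //.
  - by near: n.
  - by rewrite ge_min lexx orbT.
  - by near: n.
apply: le_trans ge; have : eps <= e / 2 by rewrite ge_min lexx.
lra.
Unshelve. all: by end_near. Qed.
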